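(* There exist absolute constants $\eta_2 > \eta_1 > 0$ and a sequence $(P_n)_{n \ge 2}$ such that for every integer $n \ge 2$, $P_n$ is a Littlewood polynomial of degree $n$ satisfying $$\eta_1 \sqrt{n} \leq |P_n(z)| \leq \eta_2 \sqrt{n} \qquad \text{for all } z \in \mathbb{C} \text{ with } |z| = 1.$$
   Context: A Littlewood polynomial of degree $n$ is a polynomial $P(z)=\sum_{j=0}^{n} a_j z^j$ with $a_j \in \{-1,1\}$ for every $j=0,1,\ldots,n$. *)

(* Defs.v *)
From mathcomp Require Import all_boot all_order all_algebra.
From mathcomp Require Import complex.

Set Implicit Arguments.
Unset Strict Implicit.
Unset Printing Implicit Defensive.

Import GRing.Theory.
Local Open Scope ring_scope.

Definition Littlewood (A : nzRingType) (n : nat) (P : {poly A}) : Prop :=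
  exists2 a : 'I_n.+1 -> A,
    forall j, a j = -1 \/ a j = 1 & P = \sum_(j < n.+1) a j *: 'X^j.

(* Main.v *)
Require Import Defs.
From mathcomp Require Import all_boot all_order all_algebra.
From mathcomp Require Import complex reals.
From mathcomp Require Import cyclic separable cyclotomic.
From mathcomp Require Import boolp sequences exp.
From mathcomp Require Import ring lra zify.

(* A polynomial of degree 2h is z^h (c(z) + 2i s(z)) on the unit circle, with c
   a cosine and s a sine polynomial whose frequencies partition {1, ..., h}.
   A pair of Rudin-Shapiro polynomials P, Q with |P|^2 + |Q|^2 constant gives
   c = 1 + 2 Re (z^(2T) P(z^2) + z^(4T) Q(z^2)).  On arcs of length O(1/T) it is
   almost a trigonometric polynomial of degree 2 in z^(2T), so it is
   O(sqrt h) everywhere, and small only near a few points of each such arc.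
   For s one first takes a fractional solution: a combination of Jackson kernels
   centred at the bad points, with one sign per cluster of bad points, is of
   size K sqrt h at the bad points and O(K sqrt h) everywhere; the signs are chosen
   by discrepancy theory so that its coefficients lie in [-1, 1], which is
   possible because the clusters are few compared with h.  Only odd sine
   frequencies are needed, and c uses only even ones.  Rounding the coefficients
   to signs, again by discrepancy theory, costs an error O(sqrt h) with a
   constant independent of K.  The construction follows Balister, Bollobas,
   Morris, Sahasrabudhe and Tiba, with all estimates reduced to orthogonality of
   roots of unity. *)

Set Implicit Arguments.
Unset Strict Implicit.
Unset Printing Implicit Defensive.

Import Order.TTheory GRing.Theory Num.Theory.
Local Open Scope ring_scope.
Local Open Scope complex_scope.

(* Inside big operators the body is parsed in ring_scope, where [^*] would be
   the conjugation of the abstract numClosedFieldType structure. *)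
Local Notation "z ^*" := (conjc z) : ring_scope.
Local Notation Re := (@complex.Re _).
Local Notation Im := (@complex.Im _).

(** * Discrepancy *)

Section ExponentialMoments.
Variable R : realType.
Implicit Types (x y a : R).

(** The sine part vanishes at 1 and -1, so the cosine part has to be large there unaided; this is
    why the Rudin-Shapiro index is even, both polynomials then being equal to [2 ^+ u] at 1. The
    constants must be fixed in a definite order. The rounding constant comes first and dictates the
    height [H] of the fractional solution, whose coefficients have size about [H / m] times the
    discrepancy of [O(T)] cluster signs against [2 * m] frequencies. The discrepancy bound used is
    of order [sqrt m * (T / m)^(1/8)]; its small exponent still lets a large constant ratio [m / T]
    absorb all other factors. A large ratio makes the separation [100 * T / m] of bad points small
    and interpolation expensive, so the threshold [kappa] defining bad points is chosen after it,
    and last the ratio [T / 4 ^ u], which controls the variation of the Rudin-Shapiro factors along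
    an arc. Odd degrees cost one extra monomial. The finitely many remaining degrees only need some
    Littlewood polynomial without zeros on the circle. *)

Definition sgb (b : bool) : R := if b then 1 else -1.

(** Everything comes from [1 + y <= expR y]: for [|y| <= 1/2] it gives
    [expR y <= 1 / (1 - y) <= 1 + y + 2 y^2], and the linear terms cancel between [x] and [- x]. *)
Lemma expR_add_expRN_le x : `|x| <= 2^-1 -> expR x + expR (- x) <= 2 * expR (2 * x ^+ 2).
Proof.
have half y : `|y| <= 2^-1 -> expR y <= 1 + y + 2 * y ^+ 2.
  rewrite ler_norml => /andP[y1 y2].
  have h : 1 - y <= expR (- y) := expR_ge1Dx (- y).
  have e0 := expR_gt0 y.
  have e1 : expR y * expR (- y) = 1 by rewrite -expRD subrr expR0.
  have : expR y * (1 - y) <= 1 by rewrite -[leRHS]e1 ler_pM2l.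
  have : 1 <= (1 + y + 2 * y ^+ 2) * (1 - y).
    have -> : (1 + y + 2 * y ^+ 2) * (1 - y) = 1 + y ^+ 2 * (1 - 2 * y) by ring.
    by rewrite lerDl mulr_ge0 ?sqr_ge0 //; lra.
  move=> h1 h2.
  have y3 : 0 < 1 - y by lra.
  by rewrite -(ler_pM2r y3) (le_trans h2 h1).
move=> hx; have h1 := half _ hx; have h2 := half (- x); rewrite normrN sqrrN in h2.
have := h2 hx; have := expR_ge1Dx (2 * x ^+ 2); lra.
Qed.

Lemma pow4_le_expR y : y ^+ 4 <= 256 * (expR y + expR (- y)).
Proof.
have pos (z : R) : 0 <= z -> z ^+ 4 <= 256 * expR z.
  move=> z0; have h := expR_ge1Dx (z / 4).
  have -> : expR z = expR (z / 4) ^+ 4.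
    by rewrite -expRM_natl; congr expR; field.
  have -> : z ^+ 4 = 256 * (z / 4) ^+ 4 by field.
  by rewrite ler_pM2l // lerXn2r ?nnegrE ?expR_ge0 //; lra.
case: (leP 0 y) => y0; first by have := pos _ y0; have := expR_gt0 (- y); lra.
have h1 := expR_gt0 y; have := pos (- y).
have -> : (- y) ^+ 4 = y ^+ 4 by ring.
by move=> h2; have := h2 ltac:(lra); lra.
Qed.

Lemma rademacher_exp_moment (I : finType) (v : I -> R) (t : R) :
  (forall i, `|t * v i| <= 2^-1) ->
  \sum_(e : {ffun I -> bool}) expR (t * \sum_i v i * sgb (e i))
    <= 2 ^+ #|I| * expR (2 * \sum_i (t * v i) ^+ 2).
Proof.
move=> tv.
have -> : \sum_(e : {ffun I -> bool}) expR (t * \sum_i v i * sgb (e i))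
   = \prod_i \sum_(b : bool) expR (t * v i * sgb b).
  rewrite bigA_distr_bigA /=; apply: eq_bigr => e _.
  by rewrite mulr_sumr expR_sum; apply: eq_bigr => i _; rewrite mulrA.
rewrite mulr_sumr expR_sum -prodr_const -big_split /=.
apply: ler_prod => i _; rewrite big_bool /sgb /= mulr1 mulrN1.
rewrite addr_ge0 ?expR_ge0 //=; exact: expR_add_expRN_le.
Qed.

Lemma rademacher_fourth_moment (I : finType) (v : I -> R) :
  (forall i, `|v i| <= 1) ->
  \sum_(e : {ffun I -> bool}) (\sum_i v i * sgb (e i)) ^+ 4
    <= 128 ^+ 2 * #|I|%:R ^+ 2 * 2 ^+ #|I|.
Proof.
move=> v1; case: (posnP #|I|) => [I0|I0].
  rewrite big1 ?I0; first by rewrite expr0n mulr0 mul0r.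
  by move=> e _; rewrite big_pred0 ?expr0n // => i; move: (fintype0 i I0).
set N := #|I|%:R : R.
have N1 : 1 <= N by rewrite ler1n.
have sN : 0 < Num.sqrt N by rewrite sqrtr_gt0; lra.
have sN2 : Num.sqrt N ^+ 2 = N by rewrite sqr_sqrtr //; lra.
have sN1 : 1 <= Num.sqrt N by nra.
(* This scale keeps each [t * v i] below 1/2 and the exponent below 1/2, so both exponential moments
   are at most [2 * 2 ^+ #|I|]. Undoing the scaling costs [t^-4 = (4 N)^2], whence
   [128^2 = 16 * 1024]. *)
pose t := (2 * Num.sqrt N)^-1.
have t0 : 0 < t by rewrite invr_gt0; lra.
have t2 : t ^+ 2 * (4 * N) = 1.
  have tV : t * (2 * Num.sqrt N) = 1 by rewrite mulVf // gt_eqF //; lra.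
  transitivity ((t * (2 * Num.sqrt N)) ^+ 2); last by rewrite tV expr1n.
  by rewrite !exprMn sN2; ring.
have tle : t <= 2^-1 by rewrite lef_pV2 ?posrE; lra.
have mom s : `|s| = t -> \sum_(e : {ffun I ->
  bool}) expR (s * \sum_i v i * sgb (e i)) <= 2 ^+ #|I| * 2.
  move=> hs; apply: (le_trans (rademacher_exp_moment _)).
    move=> i; rewrite normrM hs -[leRHS]mulr1; apply: ler_pM => //; exact: ltW.
  rewrite ler_pM2l ?exprn_gt0 //.
  have : \sum_i (s * v i) ^+ 2 <= 4^-1.
    have -> : 4^-1 = \sum_(i : I) t ^+ 2.
      have -> : \sum_(i : I) t ^+ 2 = t ^+ 2 * N by rewrite sumr_const mulr_natr.
      by lra.
    apply: ler_sum => i _; rewrite exprMn -[leRHS]mulr1 -(real_normK (num_real s)) hs.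
    rewrite ler_pM2l ?exprn_gt0 // -(real_normK (num_real (v i))).
    by rewrite expr_le1.
  move=> hsum.
  apply: (@le_trans _ _ (expR 2^-1)); first by rewrite ler_expR; lra.
  have e1 : expR (2^-1) * expR (- 2^-1) = 1 :> R by rewrite -expRD subrr expR0.
  have := expR_ge1Dx (- 2^-1 : R); have := expR_gt0 (2^-1 : R); nra.
have m1 := mom t (ger0_norm (ltW t0)).
have m2 := mom (- t); rewrite normrN (ger0_norm (ltW t0)) in m2; have {}m2 := m2 erefl.
have -> : 128 ^+ 2 * N ^+ 2 * 2 ^+ #|I| = (4 * N) ^+ 2 * (1024 * 2 ^+ #|I|) by ring.
have h : \sum_(e : {ffun I -> bool}) (t * \sum_i v i * sgb (e i)) ^+ 4 <= 1024 * 2 ^+ #|I|.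
  apply: (@le_trans _ _ (256 * (2 ^+ #|I| * 2 + 2 ^+ #|I| * 2))); last by lra.
  apply: le_trans (_ : _ <= 256 * (\sum_(e : {ffun I ->
    bool}) expR (t * \sum_i v i * sgb (e i)) + \sum_(e : {ffun I ->
    bool}) expR (- t * \sum_i v i * sgb (e i)))) _; last first.
    by rewrite ler_pM2l // lerD.
  rewrite -big_split mulr_sumr; apply: ler_sum => e _ /=; rewrite mulNr; exact: pow4_le_expR.
rewrite -ler_pdivrMl ?exprn_gt0 ?mulr_gt0 //; last by lra.
apply: le_trans h; rewrite mulr_sumr; apply: ler_sum => e _.
have t2V : (4 * N)^-1 = t ^+ 2 by rewrite -[LHS]mul1r -[X in X * _]t2 mulfK // gt_eqF //; lra.
by rewrite [leRHS]exprMn -exprVn t2V -exprM.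
Qed.

(** The integer nearest to [x / D], coded in a finite type: [None] is 0, and [Some (b, k)] is [k.+1]
    in absolute value with [b] marking a negative sign. The code is faithful only for
    [|x| <= K * D]; beyond that [inord] falls back to 0. *)
Definition cell (K : nat) (D x : R) : option (bool * 'I_K.+1) :=
  if Num.truncn (`|x| / D + 2^-1) is k.+1 then Some (x < 0, inord k) else None.

Definition cell_size (K : nat) (c : option (bool * 'I_K.+1)) : R :=
  if c is Some (_, k) then k.+1%:R else 0.

(** A nonzero cell forces [u = |x| / D >= 1/2]; then its size is at most
    [u + 1/2 <= 2 u <= (2 u)^4]. A fourth moment of [x] thus controls the mean size. *)
Lemma cell_size_le K (D x : R) : 0 < D -> cell_size (cell K D x) <= 16 * (x / D) ^+ 4.
Proof.
move=> D0; rewrite /cell.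
have u0 : 0 <= `|x| / D by rewrite divr_ge0 ?normr_ge0 // ltW.
have -> : (x / D) ^+ 4 = (`|x| / D) ^+ 4.
  by rewrite !expr_div_n -(normrX 4) ger0_norm // (exprM _ 2 2) sqr_ge0.
set u := `|x| / D in u0 *.
have /truncn_itv/andP[] : 0 <= u + 2^-1 by lra.
case: (Num.truncn _) => [|k] /= h1 h2; first by rewrite mulr_ge0 ?exprn_ge0.
have hk : k.+1%:R <= u + 2^-1 := h1.
have k1 : 1 <= k.+1%:R :> R by rewrite ler1n.
have u1 : 2^-1 <= u by lra.
apply: (@le_trans _ _ k.+1%:R).
  rewrite ler_nat ltnS; case: (leqP k K) => hkK; first by rewrite inordK.
  by apply: ltnW; apply: (leq_ltn_trans _ hkK); rewrite -ltnS ltn_ord.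
apply: (le_trans hk).
have -> : 16 * u ^+ 4 = 4 * (u * u * (4 * (u * u))) by ring.
have h3 : 1 <= 4 * (u * u) by nra.
have h4 : u * u <= u * u * (4 * (u * u)) by rewrite ler_peMr //; nra.
nra.
Qed.

Lemma cell_eq_dist K (D x y : R) : 0 < D -> `|x| <= K%:R * D -> `|y| <= K%:R * D ->
  cell K D x = cell K D y -> `|x - y| <= D.
Proof.
move=> D0 xK yK; rewrite /cell.
have tK (z : R) : `|z| <= K%:R * D -> (Num.truncn (`|z| / D + 2^-1) <= K.+1)%N.
  move=> hz; rewrite -ltnS truncn_lt_nat ?addr_ge0 ?divr_ge0 ?normr_ge0 ?(ltW D0) ?invr_ge0 //.
  have : `|z| / D <= K%:R by rewrite ler_pdivrMr.
  rewrite -[K.+2]addn2 natrD; lra.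
have iv : forall z : R, (Num.truncn (`|z| / D + 2^-1))%:R * D - D / 2 <= `|z| <= (Num.truncn
  (`|z| / D + 2^-1))%:R * D + D / 2.
  move=> z; have u0 : 0 <= `|z| / D by rewrite divr_ge0 ?normr_ge0 // ltW.
  have /truncn_itv/andP[] : 0 <= `|z| / D + 2^-1 by lra.
  set k := Num.truncn _; rewrite -[k.+1%:R]natr1 => h1 h2.
  have zE : `|z| = `|z| / D * D by rewrite divfK ?gt_eqF.
  rewrite zE; move: h1 h2; set u := `|z| / D => h1 h2; rewrite -/u.
  have h3 : 0 <= (u + 2^-1 - k%:R) * D by apply: mulr_ge0; lra.
  have h4 : 0 <= (k%:R + 1 - (u + 2^-1)) * D by apply: mulr_ge0; lra.
  by apply/andP; split; lra.
move: (tK _ xK) (tK _ yK) (iv x) (iv y).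
case: (Num.truncn (`|x| / D + _)) => [|k]; case: (Num.truncn (`|y| / D + _)) => [|l] //=.
  rewrite mul0r add0r => _ _ /andP[_ hx] /andP[_ hy] _.
  by apply: (le_trans (ler_normB _ _)); lra.
rewrite !ltnS => kK lK /andP[x1 x2] /andP[y1 y2] [sxy] /(congr1 val) /=.
rewrite !inordK ?ltnS // => kl; subst l.
move: sxy x1 x2 y1 y2; set a := k.+1%:R * D.
case: (ltP x 0) => hx; case: (ltP y 0) => hy // _;
  rewrite ?(ltr0_norm hx) ?(ltr0_norm hy) ?(ger0_norm hx) ?(ger0_norm hy);
  move=> h1 h2 h3 h4; rewrite ler_norml; apply/andP; split; lra.
Qed.

(** Two geometric series of ratio [q = expR (- a) <= 1/2], one for each sign, add at most [4 q] to
    the weight 1 of the zero cell. *)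
Lemma sum_cell_weight K a : 2 <= expR a ->
  \sum_(c : option (bool * 'I_K.+1)) expR (- a * cell_size c) <= expR (4 * expR (- a)).
Proof.
move=> ha; set q := expR (- a).
have q0 : 0 < q := expR_gt0 _.
have qa : q * expR a = 1 by rewrite /q -expRD addNr expR0.
have q2 : q <= 2^-1 by nra.
apply: le_trans (expR_ge1Dx _).
rewrite (bigD1 None) //= mulr0 expR0 lerD2l.
have -> : \sum_(i : option (bool * 'I_K.+1) | i != None) expR (- a * cell_size i)
   = \sum_(b : bool) \sum_(k < K.+1) q ^+ k.+1.
  rewrite pair_big /= (reindex_omap (fun p => Some p) id) /=; last by case.
  apply: eq_big => [[b k]|[b k] _] /=; first by rewrite eqxx.
  by rewrite mulrC expRM_natl.
rewrite big_bool /= -mulr2n -[leLHS]mulr_natl.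
have -> : \sum_(k < K.+1) q ^+ k.+1 = q * \sum_(k < K.+1) q ^+ k.
  by rewrite mulr_sumr; apply: eq_bigr => k _; rewrite exprS.
have : \sum_(k < K.+1) q ^+ k <= 2.
  have := subrX1 q K.+1; have := exprn_ge0 K.+1 (ltW q0).
  set S := \sum_(_ < _) _; set Q := q ^+ _; nra.
nra.
Qed.

(** Chernoff bound: around a member of [B], give each colouring the weight
    [expR (mu * (l - distance))]. It is at least 1 on [B], and the total weight factors over
    coordinates into powers of [1 + expR (- mu)]. *)
Lemma hamming_ball_le (I : finType) (B : {pred {ffun I -> bool}}) (l mu : R) : 0 <= mu ->
  (forall e e', e \in B -> e' \in B -> #|[set i | e i != e' i]|%:R <= l) ->
  #|B|%:R <= expR (mu * l + expR (- mu) * #|I|%:R).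
Proof.
move=> mu0 hB; case: (pickP B) => [e0 he0|B0]; last first.
  by rewrite (eq_card0 B0) expR_ge0.
apply: (@le_trans _ _ (\sum_(e : {ffun I ->
  bool}) expR (mu * l) * \prod_i (if e i == e0 i then 1 else expR (- mu)))).
  rewrite -sum1_card natr_sum; apply: le_trans (_ :
    _ <= \sum_(e in B) expR (mu * l) * \prod_i (if e i == e0 i then 1 else expR (- mu))) _.
    apply: ler_sum => e he.
    have := hB _ _ he he0; set h := #|_| => hl.
    have -> : \prod_i (if e i == e0 i then 1 else expR (- mu)) = expR (- mu * h%:R).
      rewrite mulrC expRM_natl (bigID (fun i => e i == e0 i)) /= big1 => [|i /= -> //];
        rewrite mul1r.
      rewrite (eq_bigr (fun=> expR (- mu))) => [|i /negPf -> //].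
      by rewrite prodr_const; congr (_ ^+ _); apply: eq_card => i; rewrite !inE.
    rewrite -expRD; apply: le_trans (expR_ge1Dx _).
    by rewrite lerDl; nra.
  rewrite [leRHS](bigID [in B]) /= lerDl; apply: sumr_ge0 => e _.
  by rewrite mulr_ge0 ?expR_ge0 // prodr_ge0 // => i _; case: ifP; rewrite ?expR_ge0.
rewrite -mulr_sumr -(bigA_distr_bigA (fun i b => if b == e0 i then 1 else expR (- mu))) /=.
rewrite expRD ler_pM2l ?expR_gt0 //.
rewrite mulrC expRM_natl -[#|I|]/#|{: I}| -prodr_const.
apply: ler_prod => i _; rewrite big_bool /=.
have h := expR_gt0 (- mu); have := expR_ge1Dx (expR (- mu)).
by case: (e0 i) => /= h2; rewrite ?(addrC _ 1); apply/andP; split => //; lra.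
Qed.

End ExponentialMoments.

(** * Partial colourings by exponential counting, and their iteration *)

Section PartialColoring.
Variable R : realType.
Implicit Types x y a : R.
Local Notation sgb := (@sgb R).

(** Round all sums [X j e] to multiples of [D = 128 r]; two colourings with the same code have close
    sums. If equal codes always meant agreement on 99 percent of the indices, every code would be
    shared by few colourings, while a typical code is cheap because its mean total size is small.
    Weighting codes by [expR (- a * size)] turns this conflict into a count, a substitute for the
    entropy argument. *)
Lemma partial_coloring (I J : finType) (v : J -> I -> R) (r : R) :
  (forall j i, `|v j i| <= 1) -> (0 < #|I|)%N -> (#|I| <= #|J|)%N ->
  0 <= r -> r ^+ 8 = #|I|%:R * #|J|%:R ^+ 3 ->
  exists e e' : I -> bool, #|I|%:R < 100 * #|[set i | e i != e' i]|%:R :> R /\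
    forall j, `|\sum_i v j i * sgb (e i) - \sum_i v j i * sgb (e' i)| <= 128 * r.
Proof.
move=> v1 I0 IJ r0 r8; apply: contrapT => Hno.
set N := #|I|%:R in r8; set m := #|J|%:R in r8.
have N1 : 1 <= N by rewrite ler1n.
have mN : N <= m by rewrite ler_nat.
pose X j (e : {ffun I -> bool}) := \sum_i v j i * sgb (e i).
pose D := 128 * r.
have r1 : 1 <= r.
  rewrite -(@ler_pXn2r _ 8) ?nnegrE // expr1n r8.
  by apply: mulr_ege1 => //; apply: exprn_ege1; lra.
have D0 : 0 < D by rewrite /D; lra.
pose code e : {ffun J -> option (bool * 'I_#|I|.+1)} := [ffun j => cell #|I| D (X j e)].
pose W (c : {ffun J -> option (bool * 'I_#|I|.+1)}) := \sum_j cell_size R (c j).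
have XN j e : `|X j e| <= #|I|%:R * D.
  apply: (@le_trans _ _ N); last by rewrite -/N /D; nra.
  apply: (le_trans (ler_norm_sum _ _ _)); rewrite -[N]/(#|I|%:R) -sumr_const -[leRHS]mulr1.
  rewrite mulr1; apply: ler_sum => i _; rewrite normrM /sgb.
  by case: (e i); rewrite ?normrN normr1 mulr1.
have same e e' : code e = code e' -> 100 * #|[set i | e i != e' i]|%:R <= N.
  move=> ee; rewrite leNgt; apply/negP => hN; apply: Hno.
  exists e, e'; split => // j.
  apply: (@cell_eq_dist R #|I| D (X j e) (X j e')); rewrite ?XN //.
  by move/ffunP/(_ j): ee; rewrite !ffunE.
pose s := Num.sqrt (m / N).
have N0 : N != 0 by rewrite gt_eqF //; lra.
have s2 : s ^+ 2 * N = m.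
  by rewrite sqr_sqrtr ?divfK // divr_ge0 //; lra.
have s0 : 0 <= s := sqrtr_ge0 _.
have s1 : 1 <= s by rewrite -(@ler_pXn2r _ 2) ?nnegrE // expr1n; nra.
have r4 : r ^+ 4 = m * N * s.
  apply/eqP; rewrite -(@eqrXn2 _ 2) ?exprn_ge0 ?mulr_ge0 //; try lra.
  by rewrite -exprM r8 -{1}s2 -s2; apply/eqP; ring.
(* The rate is a compromise: the mean size costs [a * w] and the sum over codes costs
   [4 * expR (- a) * m]. With [a] proportional to [sqrt (m / N)] both are at most [N / 20], and the
   final exponent stays below [N / 2]. *)
pose a := 20 * s.
pose w := m * (16 * (128 ^+ 2 * N ^+ 2) / D ^+ 4).
have D4 : 0 < D ^+ 4 by rewrite exprn_gt0.
have sumW : \sum_e W (code e) <= w * 2 ^+ #|I|.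
  rewrite exchange_big /= /w -mulrA -[m]/(#|J|%:R) mulr_natl -sumr_const.
  apply: ler_sum => j _.
  apply: (@le_trans _ _ (16 / D ^+ 4 * \sum_e X j e ^+ 4)).
    rewrite mulr_sumr; apply: ler_sum => e _; rewrite ffunE.
    by apply: (le_trans (cell_size_le _ _ D0)); rewrite expr_div_n [leRHS]mulrAC -[leRHS]mulrA.
  have := rademacher_fourth_moment (v1 j); rewrite -/N => h.
  have h2 : 0 <= 16 / D ^+ 4 by rewrite divr_ge0 // ltW.
  by have := ler_wpM2l h2 h; congr (_ <= _); field; rewrite gt_eqF.
have aw : a * w <= N / 20.
  have -> : a * w = N * (320 / 128 ^+ 2).
    rewrite /a /w /D exprMn r4; field.
    by rewrite N0 /= !gt_eqF //; lra.
  by lra.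
have a1 : 20 <= a by rewrite /a; lra.
have ea : (a / 2) ^+ 2 <= expR a.
  have -> : expR a = expR (a / 2) ^+ 2 by rewrite -expRM_natl; congr expR; field.
  have := expR_ge1Dx (a / 2) => h.
  by rewrite ler_pXn2r ?nnegrE ?expR_ge0 //; lra.
have eam : 4 * expR (- a) * m <= N / 20.
  have e1 : expR (- a) * expR a = 1 by rewrite -expRD addNr expR0.
  have e0 := expR_gt0 (- a).
  have : expR (- a) * (a / 2) ^+ 2 <= 1 by rewrite -[leRHS]e1 ler_pM2l.
  have -> : (a / 2) ^+ 2 = 100 * s ^+ 2 by rewrite /a; field.
  by move=> h; rewrite -s2; nra.
(* By convexity of exp, the average over the colourings is at least [expR 0]; if
   colourings with equal codes were always close, it would be too small. *)
have count : 2 ^+ #|I| <= \sum_e expR (a * (w - W (code e))).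
  apply: (@le_trans _ _ (\sum_e (1 + a * (w - W (code e))))); last first.
    by apply: ler_sum => e _; exact: expR_ge1Dx.
  have -> : \sum_e (1 + a * (w - W (code e))) = 2 ^+ #|I| + a * (w * 2 ^+ #|I| - \sum_e W (code e)).
    have cE x : \sum_(e : {ffun I -> bool}) x = x * 2 ^+ #|I| :> R.
      by rewrite sumr_const card_ffun card_bool -[LHS]mulr_natr natrX.
    by rewrite big_split /= cE mul1r -mulr_sumr sumrB cE.
  by rewrite lerDl mulr_ge0 ?subr_ge0 //; lra.
suff : \sum_e expR (a * (w - W (code e))) < 2 ^+ #|I| by rewrite ltNge count.
rewrite (partition_big code predT) //=.
apply: (@le_lt_trans _ _ (\sum_c expR (a * (w - W c)) * expR (4 * (N / 100) + expR (- 4) * N))).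
  apply: ler_sum => c _.
  rewrite (eq_bigr (fun=> expR (a * (w - W c)))) => [|e /eqP -> //].
  rewrite sumr_const -[leLHS]mulr_natr ler_pM2l ?expR_gt0 //.
  apply: (@hamming_ball_le _ _ [pred e | code e == c]) => // e e'.
  rewrite !inE => /eqP ec /eqP ec'.
  by have := @same e e'; rewrite ec ec' => /(_ erefl); lra.
rewrite -mulr_suml.
have -> : \sum_c expR (a * (w - W c)) = expR (a * w) * \prod_(j : J) \sum_(c :
  option (bool * 'I_#|I|.+1)) expR (- a * cell_size R c).
  rewrite bigA_distr_bigA mulr_sumr; apply: eq_bigr => c _ /=.
  by rewrite -expR_sum -mulr_sumr -expRD mulrBr mulNr.
apply: (@le_lt_trans _ _ (expR (a * w) * \prod_(j :
  J) expR (4 * expR (- a)) * expR (4 * (N / 100) + expR (-4) * N))).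
  rewrite ler_pM2r ?expR_gt0 // ler_pM2l ?expR_gt0 //; apply: ler_prod => j _.
  rewrite sumr_ge0 => [|c _]; last exact: expR_ge0.
  by apply: sum_cell_weight; have := expR_ge1Dx a; lra.
rewrite prodr_const -expRM_natr -!expRD.
have e4 : expR (-4) <= 5^-1 :> R.
  have := expR_ge1Dx (4 : R); have := expR_gt0 (4 : R); have :
    expR (-4) * expR 4 = 1 :> R by rewrite -expRD addNr expR0.
  nra.
apply: (@lt_le_trans _ _ (expR (#|I|%:R * 2^-1))).
  rewrite ltr_expR -/N -/m; nra.
rewrite expRM_natl lerXn2r ?nnegrE ?expR_ge0 //.
have e1 : expR (2^-1) * expR (- 2^-1) = 1 :> R by rewrite -expRD subrr expR0.
have := expR_ge1Dx (- 2^-1 : R); have := expR_gt0 (2^-1 : R); nra.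
Qed.

Definition root8 x := Num.sqrt (Num.sqrt (Num.sqrt x)).

Lemma root8_ge0 x : 0 <= root8 x. Proof. exact: sqrtr_ge0. Qed.

Lemma root8K x : 0 <= x -> root8 x ^+ 8 = x.
Proof. by move=> x0; rewrite (exprM _ 2 4) sqr_sqrtr ?sqrtr_ge0 // (exprM _ 2 2) !sqr_sqrtr
  ?sqrtr_ge0. Qed.

Lemma root8_le x y : 0 <= x -> 0 <= y -> x <= y ^+ 8 -> root8 x <= y.
Proof. by move=> x0 y0 xy; rewrite -(@ler_pXn2r _ 8) ?nnegrE ?root8_ge0 // root8K. Qed.

(* Weaker than Spencer's bound, since it only uses a fourth moment; but it decays
   geometrically as |I| shrinks, so that partial colourings can be iterated. *)
Lemma discrepancy_le (I J : finType) (v : J -> I -> R) :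
  (forall j i, `|v j i| <= 1) -> (#|I| <= #|J|)%N ->
  exists e : I -> bool, forall j,
    `|\sum_i v j i * sgb (e i)| <= 64 * 1000 * root8 (#|I|%:R * #|J|%:R ^+ 3).
Proof.
move: {2}#|I| (leqnn #|I|) => n; elim: n I v => [|n IH] I v.
  rewrite leqn0 => /eqP I0 _ _; exists (fun=> true) => j.
  rewrite big_pred0 ?normr0 ?mulr_ge0 ?root8_ge0 // => i.
  by move: (fintype0 i I0).
move=> In v1 IJ; case: (posnP #|I|) => [I0|I0].
  by apply: IH => //; rewrite I0.
set r := root8 _.
have rge : 0 <= r := root8_ge0 _.
have X0 : 0 <= #|I|%:R * #|J|%:R ^+ 3 :> R by rewrite mulr_ge0 ?exprn_ge0.
have r8 : r ^+ 8 = #|I|%:R * #|J|%:R ^+ 3 := root8K X0.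
have [e [e' [dif he]]] := partial_coloring v1 I0 IJ rge r8.
pose A := [pred i | e i == e' i].
pose I' := {i : I | i \in A}.
have cardI' : (#|{: I'}| + #|[set i | e i != e' i]| = #|I|)%N.
  by rewrite card_sig -(cardC A); congr addn; apply: eq_card => i; rewrite !inE.
have dpos : (0 < #|[set i | e i != e' i]|)%N.
  by rewrite lt0n; apply/eqP => d0; move: dif; rewrite d0 mulr0 ltNge ler0n.
have c1 : (#|{: I'}| <= n)%N.
  by rewrite -ltnS (leq_trans _ In) // -cardI' -[X in (X < _)%N]addn0 ltn_add2l.
have c2 : (#|{: I'}| <= #|J|)%N.
  by apply: leq_trans IJ; rewrite -cardI' leq_addr.
have [f hf] := IH {: I'} (fun j i => v j (val i)) c1 (fun j i => v1 j (val i)) c2.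
exists (fun i => if insub i is Some u then f u else e i) => j.
have h1 := he j; have {hf} := hf j.
set r' := root8 _ => h2.
(* At most 99/100 of the indices remain, and [(999/1000)^8 >= 99/100]. The costs [64 r] of
   successive rounds are thus dominated by a geometric series with sum [64 * 1000 * r]. *)
have rr : r' <= 999 / 1000 * r.
  apply: root8_le; [by rewrite mulr_ge0 ?exprn_ge0 | lra |].
  rewrite exprMn r8 [leRHS]mulrA; apply: ler_wpM2r; first by rewrite exprn_ge0.
  apply: (@le_trans _ _ (99 / 100 * #|I|%:R)); last by apply: ler_wpM2r => //; lra.
  have : #|I|%:R = #|{: I'}|%:R + #|[set i | e i != e' i]|%:R :> R by rewrite -natrD cardI'.
  move: dif; set d := #|[set _ | _]|%:R; set k := #|I|%:R; set l := #|{: I'}|%:R.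
  lra.
(* Half the difference of the two colourings is [e] where they differ and 0 where they agree; the
   recursive colouring [f] fills in the zeros. *)
have -> : \sum_i v j i * sgb (if insub i is Some u then f u else e i) =
    2^-1 * (\sum_i v j i * sgb (e i) - \sum_i v j i * sgb (e' i)) + \sum_(u :
      I') v j (val u) * sgb (f u).
  have -> : \sum_(u : I') v j (val u) * sgb (f u) = \sum_(u :
    I') v j (val u) * sgb (if insub (val u) is Some u then f u else e (val u)).
    by apply: eq_bigr => u _; rewrite valK.
  rewrite -(big_sub A (fun i => v j i * sgb (if insub i is Some u then f u else e i))) /=.
  rewrite -sumrB mulr_sumr [X in _ + X]big_mkcond -big_split /=; apply: eq_bigr => i _.
  case: insubP => [u|]; rewrite !inE.
    by move=> /eqP ee ui; rewrite ee eqxx; ring.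
  by case: (e i) (e' i) => -[] //= _; rewrite /sgb /=; clear; lra.
apply: (le_trans (ler_normD _ _)); rewrite normrM ger0_norm ?invr_ge0 //; lra.
Qed.

End PartialColoring.

(** * From discrepancy to rounding of fractional solutions *)

Section Rounding.
Variable R : realType.
Implicit Types x y a : R.
Local Notation sgb := (@sgb R).

Lemma hereditary_discrepancy_le (I J : finType) (v : J -> I -> R) (A : {set I}) :
  (forall j i, `|v j i| <= 1) -> (#|I| <= #|J|)%N ->
  exists e : I -> bool, forall j,
    `|\sum_(i in A) v j i * sgb (e i)| <= 64 * 1000 * Num.sqrt #|J|%:R.
Proof.
move=> v1 IJ; pose I' := {i : I | i \in A}.
have cI : (#|{: I'}| <= #|J|)%N.
  by rewrite card_sig (leq_trans _ IJ) // max_card.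
have [f hf] := @discrepancy_le R {: I'} J (fun j i => v j (val i)) (fun j i => v1 j (val i)) cI.
exists (fun i => if insub i is Some u then f u else true) => j.
rewrite big_sub; under eq_bigr do rewrite valK.
apply: (le_trans (hf j)); rewrite ler_pM2l ?mulr_gt0 //.
apply: root8_le; [by rewrite mulr_ge0 ?exprn_ge0|exact: sqrtr_ge0|].
rewrite (exprM _ 2 4) sqr_sqrtr // [leRHS]exprS; apply: ler_wpM2r; first by rewrite exprn_ge0.
by rewrite ler_nat.
Qed.

(* Lovasz, Spencer and Vesztergombi: round the last binary digits by a colouring
   of the indices where that digit is 1, and recurse. *)
Lemma dyadic_rounding (I J : finType) (v : J -> I -> R) (h : R) (L : nat) (a : I -> nat) :
  (forall A : {set I}, exists e : I -> bool, forall j, `|\sum_(i in A) v j i * sgb (e i)| <= h) ->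
  (forall i, (a i <= 2 ^ L)%N) ->
  exists e : I -> bool, forall j,
    `|\sum_i v j i * (sgb (e i) - (2 * (a i)%:R / 2 ^+ L - 1))| <= (2 - 2 / 2 ^+ L) * h.
Proof.
move=> hA; elim: L a => [|L IH] a aL.
  exists (fun i => a i == 1%N) => j; rewrite big1 ?normr0 ?expr0 ?divr1 ?subrr ?mul0r // => i _.
  by have := aL i; rewrite expn0 /sgb; case: (a i) => [|[|k]] //= _; lra.
have [e' he'] := hA [set i | odd (a i)].
(* An odd numerator is rounded up or down according to [e'], which shifts the target by
   [sgb (e' i) / 2 ^+ L]. This level therefore costs [h / 2 ^+ L], and all levels together less than
   [2 h]. *)
pose b i := (a i + (odd (a i) && e' i))./2.
have bE i : 2 * (b i)%:R = (a i)%:R + (if odd (a i) then sgb (e' i) else 0) :> R.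
  rewrite -natrM mul2n /b /sgb; case: (boolP (odd (a i))) => ai /=.
    case: (e' i) => /=.
      by rewrite addn1 halfK /= ai /= subn0 -natr1.
    by rewrite addn0 halfK ai natrB ?(odd_gt0 ai).
  by rewrite addn0 halfK (negPf ai) subn0 addr0.
have bL i : (b i <= 2 ^ L)%N.
  have := aL i; rewrite expnS /b; case: (boolP (odd (a i))) => ai /=; case: (e' i) => /=; lia.
have [e he] := IH b bL; exists e => j.
have p0 : 2 ^+ L != 0 :> R by rewrite expf_eq0 pnatr_eq0 andbF.
have -> : \sum_i v j i * (sgb (e i) - (2 * (a i)%:R / 2 ^+ L.+1 - 1)) =
   \sum_i v j i * (sgb (e i) - (2 * (b i)%:R / 2 ^+ L - 1)) + (2 ^+ L)^-1 * \sum_(i in [set i |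
     odd (a i)]) v j i * sgb (e' i).
  rewrite mulr_sumr [X in _ + X]big_mkcond -big_split /=; apply: eq_bigr => i _.
  rewrite bE inE exprS; case: (odd (a i)); field; rewrite p0 //=.
apply: (le_trans (ler_normD _ _)); have h1 := he j; have h2 := he' j.
have p1 : 0 < (2 ^+ L)^-1 :> R by rewrite invr_gt0 exprn_gt0.
rewrite normrM (gtr0_norm p1).
have -> : (2 - 2 / 2 ^+ L.+1) * h = (2 - 2 / 2 ^+ L) * h + (2 ^+ L)^-1 * h by rewrite exprS; field.
by rewrite lerD // ler_pM2l.
Qed.

Lemma sign_rounding (I J : finType) (v : J -> I -> R) (x : I -> R) :
  (forall j i, `|v j i| <= 1) -> (#|I| <= #|J|)%N -> (forall i, `|x i| <= 1) ->
  exists e : I -> bool, forall j,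
    `|\sum_i v j i * (sgb (e i) - x i)| <= 128 * 1000 * Num.sqrt #|J|%:R + 2.
Proof.
move=> v1 IJ x1; pose h : R := 64 * 1000 * Num.sqrt #|J|%:R.
(* Truncating each [x i] to this many digits costs at most [2 / 2 ^+ #|I|], so the total truncation
   error is at most [#|I| * 2 / 2 ^+ #|I| <= 2]. *)
pose L := #|I|; pose p : R := 2 ^+ L.
have p0 : 0 < p by rewrite exprn_gt0.
pose a i := Num.truncn (p * (x i + 1) / 2).
have xb i : 0 <= x i + 1 <= 2 by have := x1 i; rewrite ler_norml => /andP[? ?]; apply/andP;
  split; lra.
have aE i : (a i)%:R <= p * (x i + 1) / 2 < (a i)%:R + 1.
  have /andP[x2 x3] := xb i.
  by rewrite natr1 truncn_itv // divr_ge0 // mulr_ge0 // ltW.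
have aL i : (a i <= 2 ^ L)%N.
  rewrite -(ler_nat R) natrX -/p; have /andP[x2 x3] := xb i; have /andP[h1 h2] := aE i.
  by apply: (le_trans h1); nra.
have [e he] := dyadic_rounding (fun A => hereditary_discrepancy_le A v1 IJ) aL.
exists e => j.
have -> : \sum_i v j i * (sgb (e i) - x i) = \sum_i v j i * (sgb (e i) - (2 * (a i)%:R / p - 1))
  + \sum_i v j i * (2 * (a i)%:R / p - 1 - x i).
  by rewrite -big_split; apply: eq_bigr => i _ /=; ring.
apply: (le_trans (ler_normD _ _)); apply: lerD.
  apply: (le_trans (he j)); rewrite -/h.
  have -> : 128 * 1000 * Num.sqrt #|J|%:R = 2 * h by rewrite /h; ring.
  apply: ler_wpM2r; first by rewrite !mulr_ge0 ?sqrtr_ge0.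
  by rewrite gerDl oppr_le0 divr_ge0 ?exprn_ge0.
apply: (le_trans (ler_norm_sum _ _ _)).
apply: (@le_trans _ _ (\sum_(i : I) 2 / p)).
  apply: ler_sum => i _; rewrite normrM -[leRHS]mul1r; apply: ler_pM => //.
  have /andP[h1 h2] := aE i.
  have -> : 2 * (a i)%:R / p - 1 - x i = 2 / p * ((a i)%:R - p * (x i + 1) / 2) by field;
    rewrite gt_eqF.
  rewrite normrM ger0_norm ?divr_ge0 ?(ltW p0) // -[leRHS]mulr1 ler_pM2l ?divr_gt0 //.
  by rewrite ler_norml; apply/andP; split; lra.
rewrite sumr_const -[leLHS]mulr_natr mulrAC ler_pdivrMr // ler_pM2l //.
by rewrite /p -natrX ler_nat ltnW // ltn_expl.
Qed.

End Rounding.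

(** * Sums over roots of unity *)

Section Modulus.
Variable R : realType.
Implicit Types (z w y : R[i]) (x : R).

(** The norm of [R[i]] takes its values in [R[i]]; this is the same modulus with values in the
    ordered field [R]. *)
Definition cabs z : R := Num.sqrt (Re z ^+ 2 + Im z ^+ 2).

Lemma normc_cabs z : `|z| = (cabs z)%:C. Proof. exact: normc_def. Qed.

Lemma cabs_ge0 z : 0 <= cabs z. Proof. exact: sqrtr_ge0. Qed.

Lemma cabs_sqr z : cabs z ^+ 2 = Re z ^+ 2 + Im z ^+ 2.
Proof. by rewrite sqr_sqrtr // addr_ge0 ?sqr_ge0. Qed.

Lemma cabsM z w : cabs (z * w) = cabs z * cabs w.
Proof. by apply: complexI; rewrite rmorphM /= -!normc_cabs normrM. Qed.

Lemma cabs0 : cabs 0 = 0. Proof. by apply: complexI; rewrite -normc_cabs normr0 rmorph0. Qed.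

Lemma cabs1 : cabs 1 = 1. Proof. by apply: complexI; rewrite -normc_cabs normr1 rmorph1. Qed.

Lemma cabsN z : cabs (- z) = cabs z.
Proof. by apply: complexI; rewrite -!normc_cabs normrN. Qed.

Lemma cabsBC z w : cabs (z - w) = cabs (w - z). Proof. by rewrite -cabsN opprB. Qed.

Lemma cabsJ z : cabs z^* = cabs z.
Proof. by apply: complexI; rewrite -!normc_cabs normcJ. Qed.

Lemma cabsX z n : cabs (z ^+ n) = cabs z ^+ n.
Proof. by elim: n => [|n IH]; rewrite ?expr0 ?cabs1 // !exprS cabsM IH. Qed.

Lemma cabs_real x : cabs x%:C = `|x|.
Proof. by rewrite /cabs /= expr0n /= addr0 sqrtr_sqr. Qed.

Lemma cabs_nat n : cabs n%:R = n%:R.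
Proof. by apply: complexI; rewrite -normc_cabs normr_nat rmorph_nat. Qed.

Lemma cabsD z w : cabs (z + w) <= cabs z + cabs w.
Proof. by rewrite -lecR rmorphD /= -!normc_cabs; exact: ler_normD. Qed.

Lemma cabsB z w : cabs (z - w) <= cabs z + cabs w.
Proof. by rewrite -(cabsN w) cabsD. Qed.

Lemma cabs_sub_ge z w : cabs z - cabs w <= cabs (z - w).
Proof. by have := cabsD (z - w) w; rewrite subrK; lra. Qed.

Lemma cabs_dist z y w : cabs (z - w) <= cabs (z - y) + cabs (y - w).
Proof.
have -> : z - w = (z - y) + (y - w) by ring.
exact: cabsD.
Qed.

Lemma cabs_sum (I : Type) (r : seq I) (P : pred I) (F : I -> R[i]) :
  cabs (\sum_(i <- r | P i) F i) <= \sum_(i <- r | P i) cabs (F i).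
Proof.
elim/big_ind2: _ => [|z a w b hz hw|//]; first by rewrite cabs0.
by apply: (le_trans (cabsD _ _)); apply: lerD.
Qed.

Lemma Re_le_cabs z : `|Re z| <= cabs z.
Proof. by rewrite -sqrtr_sqr ler_wsqrtr // lerDl sqr_ge0. Qed.

Lemma Im_le_cabs z : `|Im z| <= cabs z.
Proof. by rewrite -sqrtr_sqr ler_wsqrtr // lerDr sqr_ge0. Qed.

Lemma mul_conjc z : z * z^* = (cabs z ^+ 2)%:C.
Proof. by rewrite -sqr_normc normc_cabs rmorphXn. Qed.

Lemma unit_conj z : cabs z = 1 -> z * z^* = 1.
Proof. by move=> h; rewrite mul_conjc h expr1n. Qed.

Lemma unit_conjX z n : cabs z = 1 -> z ^+ n * z^* ^+ n = 1.
Proof. by move=> h; rewrite -exprMn unit_conj // expr1n. Qed.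

Lemma conjcN z : (- z)^* = - z^*.
Proof. exact: rmorphN. Qed.

Lemma conjcX z n : (z ^+ n)^* = z^* ^+ n.
Proof. exact: rmorphXn. Qed.

Lemma cabs_subX z w n : cabs z = 1 -> cabs w = 1 -> cabs (z ^+ n - w ^+ n) <= n%:R * cabs (z - w).
Proof.
move=> z1 w1; rewrite subrXX cabsM mulrC; apply: ler_wpM2r; first exact: cabs_ge0.
apply: (le_trans (cabs_sum _ _ _)); rewrite -[n in n%:R]card_ord -sumr_const.
by apply: ler_sum => i _; rewrite cabsM !cabsX z1 w1 !expr1n mulr1.
Qed.

Lemma Re_sum (I : Type) (r : seq I) (P : pred I) (F : I -> R[i]) :
  Re (\sum_(i <- r | P i) F i) = \sum_(i <- r | P i) Re (F i).
Proof. by apply: (big_morph Re) => // [[a b] [c d]]. Qed.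

Lemma ReD z w : Re (z + w) = Re z + Re w.
Proof. by case: z; case: w. Qed.

Lemma ReB z w : Re (z - w) = Re z - Re w.
Proof. by case: z; case: w. Qed.

Lemma ImD z w : Im (z + w) = Im z + Im w.
Proof. by case: z; case: w. Qed.

Lemma Im_sum (I : Type) (r : seq I) (P : pred I) (F : I -> R[i]) :
  Im (\sum_(i <- r | P i) F i) = \sum_(i <- r | P i) Im (F i).
Proof. by apply: (big_morph Im) => // [[a b] [c d]]. Qed.

Lemma ReZ x z : Re (x%:C * z) = x * Re z.
Proof. by case: z => a b /=; ring. Qed.

Lemma ReJ z : Re z^* = Re z. Proof. by case: z. Qed.

Lemma ImJ z : Im z^* = - Im z. Proof. by case: z. Qed.

Lemma cabs_mul_conj_sub z w : cabs z = 1 -> cabs (z^* * w - 1) = cabs (z - w).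
Proof.
move=> z1; have -> : z^* * w - 1 = z^* * (w - z) by rewrite mulrBr -(unit_conj z1) [z * _]mulrC.
by rewrite cabsM cabsJ z1 mul1r cabsBC.
Qed.

End Modulus.

(** * Dirichlet kernels on roots of unity: packing, covering and norming *)

Section RootsOfUnity.
Variable R : realType.
Implicit Types (z w y : R[i]) (x : R).

Lemma prim_root_exists (M : nat) : (0 < M)%N -> exists zeta : R[i], M.-primitive_root zeta.
Proof.
move=> M0; pose p : {poly R[i]} := 'X^M - 1.
have [r Dp] := closed_field_poly_normal p.
rewrite (monicP _) ?monicXnsubC // scale1r in Dp.
have rM : all M.-unity_root r by apply/allP=> z; rewrite -root_prod_XsubC -Dp.
have szr : (M < (size r).+1)%N by rewrite -(size_prod_XsubC r id) -Dp size_XnsubC.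
have [|z] := hasP (has_prim_root M0 rM _ szr); last by exists z.
by rewrite -separable_prod_XsubC -Dp separable_Xn_sub_1 // pnatr_eq0 -lt0n.
Qed.

Definition dirichlet (a : nat) y : R[i] := \sum_(k < a) y ^+ k.

Lemma dirichlet_le a y : cabs y = 1 -> cabs (dirichlet a y) <= a%:R.
Proof.
move=> y1; apply: (le_trans (cabs_sum _ _ _)); rewrite -[a in a%:R]card_ord -sumr_const.
by apply: ler_sum => k _; rewrite cabsX y1 expr1n.
Qed.

Lemma dirichlet_far a y : cabs y = 1 -> cabs (dirichlet a y) * cabs (y - 1) <= 2.
Proof.
move=> y1; rewrite mulrC -cabsM -subrX1; apply: (le_trans (cabsB _ _)).
by rewrite cabsX y1 expr1n cabs1.
Qed.

Lemma dirichlet_near a y : cabs y = 1 -> a%:R * cabs (y - 1) <= 2^-1 ->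
  a%:R / 2 <= cabs (dirichlet a y).
Proof.
move=> y1 ha; have : cabs (a%:R - dirichlet a y) <= a%:R / 2.
  have -> : a%:R - dirichlet a y = \sum_(k < a) (1 ^+ k - y ^+ k).
    by rewrite sumrB; congr (_ - _); under eq_bigr do rewrite expr1n; rewrite sumr_const card_ord.
  apply: (le_trans (cabs_sum _ _ _)).
  have -> : a%:R / 2 = \sum_(k < a) 2^-1 :> R by rewrite sumr_const card_ord mulr_natl.
  apply: ler_sum => k _; apply: (le_trans (cabs_subX _ _ y1)); first exact: cabs1.
  rewrite cabsBC; apply: le_trans ha; apply: ler_wpM2r; first exact: cabs_ge0.
  by rewrite ler_nat ltnW.
by have := cabs_sub_ge a%:R (dirichlet a y); rewrite cabs_nat; lra.
Qed.

Variables (M : nat) (zeta : R[i]).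
Hypothesis zeta_prim : M.-primitive_root zeta.
Local Notation W p := (zeta ^+ p).

Let M_gt0 : (0 < M)%N := prim_order_gt0 zeta_prim.

Lemma prim_root_unit : cabs zeta = 1.
Proof.
apply/eqP; rewrite -(@pexpr_eq1 _ _ M) ?cabs_ge0 // -?lt0n //.
by rewrite -cabsX (prim_expr_order zeta_prim) cabs1.
Qed.

Lemma prim_rootX_unit p : cabs (W p) = 1.
Proof. by rewrite cabsX prim_root_unit expr1n. Qed.

Lemma unit_expr_inj z n k : cabs z = 1 -> z ^+ n * z^* ^+ k = 1 -> z ^+ n = z ^+ k.
Proof.
by move=> z1 h; rewrite -[RHS]mul1r -h -mulrA -exprMn [z^* * z]mulrC unit_conj // expr1n mulr1.
Qed.

Lemma roots_orthogonal i j : (i < M)%N -> (j < M)%N ->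
  \sum_(p < M) W p ^+ i * (W p)^* ^+ j = if i == j then M%:R else 0.
Proof.
move=> iM jM.
have -> : \sum_(p < M) W p ^+ i * (W p)^* ^+ j = \sum_(p < M) (zeta ^+ i * zeta^* ^+ j) ^+ p.
  by apply: eq_bigr => p _; rewrite conjcX exprMn -!exprM ![(p * _)%N]mulnC.
set q := zeta ^+ i * _.
case: eqP => [ij|/eqP ij].
  rewrite (eq_bigr (fun=> 1)) => [|p _]; first by rewrite sumr_const card_ord.
  by rewrite /q ij unit_conjX ?prim_root_unit // expr1n.
have q1 : q - 1 != 0.
  rewrite subr_eq0; apply: contraNneq ij => /(unit_expr_inj prim_root_unit)/eqP.
  by rewrite (eq_prim_root_expr zeta_prim) !modn_small.
apply: (mulfI q1); rewrite -subrX1 mulr0 /q exprMn -!exprM ![(_ * M)%N]mulnC !exprM.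
by rewrite -conjcX !(prim_expr_order zeta_prim) conjc1 !expr1n mulr1 subrr.
Qed.

Lemma roots_inner_product a b (f g : nat -> R[i]) : (a <= M)%N -> (b <= M)%N ->
  \sum_(p < M) (\sum_(i < a) f i * W p ^+ i) * (\sum_(j < b) g j * W p ^+ j)^*
  = M%:R * \sum_(i < a) \sum_(j < b | j == i :> nat) f i * (g j)^*.
Proof.
move=> aM bM.
have Ep (p : 'I_M) : (\sum_(i < a) f i * W p ^+ i) * (\sum_(j < b) g j * W p ^+ j)^*
   = \sum_(i < a) \sum_(j < b) f i * (g j)^* * (W p ^+ i * (W p)^* ^+ j).
  rewrite mulr_suml; apply: eq_bigr => i _; rewrite rmorph_sum mulr_sumr.
  by apply: eq_bigr => j _; rewrite /= rmorphM /= (conjcX (W p)); ring.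
rewrite (eq_bigr _ (fun p _ => Ep p)) exchange_big mulr_sumr /=; apply: eq_bigr => i _.
rewrite exchange_big mulr_sumr /= [RHS]big_mkcond; apply: eq_bigr => j _.
rewrite -mulr_sumr roots_orthogonal ?(leq_trans (ltn_ord _)) // eq_sym.
by case: eqP => _; rewrite ?mulr0 // mulrC.
Qed.

Lemma roots_parseval a (f : nat -> R[i]) : (a <= M)%N ->
  \sum_(p < M) cabs (\sum_(i < a) f i * W p ^+ i) ^+ 2 = M%:R * \sum_(i < a) cabs (f i) ^+ 2.
Proof.
move=> aM; apply: complexI; rewrite rmorphM rmorph_nat !rmorph_sum /=.
under eq_bigr => p _ do rewrite -mul_conjc.
rewrite roots_inner_product //; congr (_ * _); apply: eq_bigr => i _.
by rewrite (big_pred1 i) => [|j]; rewrite ?mul_conjc.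
Qed.

Lemma dirichlet_rotate a z p : dirichlet a (z^* * W p) = \sum_(i < a) z^* ^+ i * W p ^+ i.
Proof. by apply: eq_bigr => i _; rewrite exprMn. Qed.

Lemma dirichlet_square_sum a z : (a <= M)%N -> cabs z = 1 ->
  \sum_(p < M) cabs (dirichlet a (z^* * W p)) ^+ 2 = M%:R * a%:R.
Proof.
move=> aM z1; under eq_bigr do rewrite dirichlet_rotate.
rewrite (@roots_parseval a (fun i => z^* ^+ i)) //; congr (_ * _).
rewrite (eq_bigr (fun=> 1)) => [|i _]; last by rewrite cabsX cabsJ z1 !expr1n.
by rewrite sumr_const card_ord.
Qed.

Lemma rotate_unit z p : cabs z = 1 -> cabs (z^* * W p) = 1.
Proof. by move=> z1; rewrite cabsM cabsJ z1 mul1r prim_rootX_unit. Qed.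

(** Each root counted contributes at least [(a / 2)^2] to the square sum of the Dirichlet kernel
    centred at [z], which is [M * a] by Parseval. *)
Lemma roots_packing a z (r : R) : (0 < a <= M)%N -> cabs z = 1 -> a%:R * r <= 2^-1 ->
  (#|[set p : 'I_M | (cabs (z - W p) <= r)%R]| * a <= 4 * M)%N.
Proof.
case/andP=> a0 aM z1 ar; set S := [set p | _].
have h := dirichlet_square_sum aM z1.
have a0' : 0 < a%:R :> R by rewrite ltr0n.
have : \sum_(p in S) (a%:R / 2) ^+ 2 <= M%:R * a%:R :> R.
  rewrite -h [leRHS](bigID [in S]) /= -[leLHS]addr0 lerD //; last first.
    by apply: sumr_ge0 => p _; rewrite exprn_ge0 ?cabs_ge0.
  apply: ler_sum => p; rewrite inE => hp.
  rewrite ler_pXn2r ?nnegrE ?cabs_ge0 ?divr_ge0 //.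
  apply: dirichlet_near; first exact: rotate_unit.
  by rewrite cabs_mul_conj_sub // (le_trans _ ar) // ler_pM2l.
rewrite sumr_const -[leLHS]mulr_natr -(ler_nat R) !natrM => h2.
by rewrite -(ler_pM2r a0'); nra.
Qed.

Lemma rotated_orthogonal z i j : cabs z = 1 -> (i < M)%N -> (j < M)%N ->
  \sum_(p < M) (z^* * W p) ^+ i * (z^* * W p)^* ^+ j = if i == j then M%:R else 0.
Proof.
move=> z1 iM jM; transitivity (z^* ^+ i * z ^+ j * \sum_(p < M) W p ^+ i * (W p)^* ^+ j).
  rewrite mulr_sumr; apply: eq_bigr => p _.
  by rewrite !exprMn rmorphM /= conjcK exprMn; ring.
rewrite roots_orthogonal //; case: eqP => [->|_]; last by rewrite mulr0.
by rewrite [z^* ^+ _ * _]mulrC unit_conjX // mul1r.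
Qed.

(* The correlation of [D_a^2] with [D_(2a)] is [M a^2], too large for [D_a] to be
   below [a/2] at all rotated roots of unity. *)
Lemma roots_cover a z : (0 < a)%N -> (2 * a <= M)%N -> cabs z = 1 ->
  exists p : 'I_M, cabs (z - W p) <= 4 / a%:R.
Proof.
move=> a0 aM z1; apply: contrapT => Hno.
have far (p : 'I_M) : 4 / a%:R < cabs (z - W p) by rewrite ltNge; apply/negP => h; apply: Hno;
  exists p.
have a0' : 0 < a%:R :> R by rewrite ltr0n.
have M0' : 0 < M%:R :> R by rewrite ltr0n.
have aM' : (a <= M)%N by lia.
pose Y (p : 'I_M) := z^* * W p.
have Y1 p : cabs (Y p) = 1 by apply: rotate_unit.
have E : \sum_(p < M) dirichlet a (Y p) ^+ 2 * (dirichlet (2 * a) (Y p))^* = (M * a ^ 2)%:R.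
  have Ep (p : 'I_M) : dirichlet a (Y p) ^+ 2 * (dirichlet (2 * a) (Y p))^* =
      \sum_(i < a) \sum_(j < a) \sum_(k < 2 * a) Y p ^+ (i + j) * (Y p)^* ^+ k.
    rewrite expr2 /dirichlet mulr_suml mulr_suml; apply: eq_bigr => i _.
    rewrite mulr_sumr mulr_suml; apply: eq_bigr => j _.
    rewrite rmorph_sum mulr_sumr; apply: eq_bigr => k _.
    by rewrite /= conjcX exprD.
  rewrite (eq_bigr _ (fun p _ => Ep p)) exchange_big /=.
  rewrite (eq_bigr (fun=> (a * M)%:R)) => [|i _].
    by rewrite sumr_const card_ord -[LHS]mulr_natr -natrM; congr (_%:R); lia.
  rewrite exchange_big /= (eq_bigr (fun=> M%:R)) => [|j _].
    by rewrite sumr_const card_ord -[LHS]mulr_natl natrM.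
  have ij : (i + j < 2 * a)%N by have := ltn_ord i; have := ltn_ord j; lia.
  rewrite exchange_big /= (bigD1 (Ordinal ij)) //= rotated_orthogonal ?eqxx ?(leq_trans ij) //.
  rewrite big1 ?addr0 // => k kij;
    rewrite rotated_orthogonal ?(leq_trans ij) ?(leq_trans (ltn_ord k)) //.
  by case: eqP => // h; move: kij; rewrite -val_eqE /= -h eqxx.
have h1 := dirichlet_square_sum aM' z1.
have h2 := dirichlet_square_sum aM z1.
(* With this bound and [c * d <= (c^2 + d^2) / 2], the correlation is at most
   [a / 2 * (M a + 2 M a) / 2 = 3/4 * M a^2], which contradicts its exact value. *)
have near (p : 'I_M) : cabs (dirichlet a (Y p)) <= a%:R / 2.
  have := dirichlet_far a (Y1 p); rewrite /Y cabs_mul_conj_sub // => h3.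
  have f1 : 4 < cabs (z - W p) * a%:R by rewrite -ltr_pdivrMr.
  have := cabs_ge0 (dirichlet a (z^* * W p)); set d := cabs _ in h3 *; set u :=
    cabs _ in h3 f1 * => d0.
  by nra.
have : (M * a ^ 2)%:R <= a%:R / 2 * (\sum_(p < M) cabs (dirichlet a (Y p)) * cabs (dirichlet (2 *
  a) (Y p))).
  rewrite -cabs_nat -E; apply: (le_trans (cabs_sum _ _ _)); rewrite mulr_sumr; apply: ler_sum =>
    p _.
  rewrite cabsM cabsJ expr2 cabsM mulrA; apply: ler_wpM2r; first exact: cabs_ge0.
  by apply: ler_wpM2r; [exact: cabs_ge0|exact: near].
have : \sum_(p < M) cabs (dirichlet a (Y p)) * cabs (dirichlet (2 * a) (Y p)) <= 2^-1 * (M%:R *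
  a%:R + M%:R * (2 * a)%:R).
  rewrite -h1 -h2 -big_split mulr_sumr; apply: ler_sum => p _ /=.
  rewrite -/(Y p); set c := cabs _; set d := cabs _; have := sqr_ge0 (c - d); nra.
rewrite !natrM => g1 g2.
have : 0 < M%:R * a%:R ^+ 2 :> R by rewrite mulr_gt0 ?exprn_gt0.
have : a%:R / 2 * (\sum_(p < M) cabs (dirichlet a (Y p)) * cabs (dirichlet (2 * a) (Y p))) <=
  a%:R / 2 * (2^-1 * (M%:R * a%:R + M%:R * (2 * a%:R))).
  by rewrite ler_pM2l // divr_gt0.
nra.
Qed.

(* The kernel [D_(2L) conj(D_L) / L] has coefficients 1 at 0, ..., L - 1. *)
Lemma roots_norming (L : nat) (g : nat -> R[i]) (b : R) z : (0 < L)%N -> (2 * L <= M)%N ->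
  cabs z = 1 ->
  (forall p : 'I_M, cabs (\sum_(l < L) g l * W p ^+ l) <= b) ->
  cabs (\sum_(l < L) g l * z ^+ l) <= 3 / 2 * b.
Proof.
move=> L0 LM z1 hb.
have L0' : 0 < L%:R :> R by rewrite ltr0n.
have M0' : 0 < M%:R :> R by rewrite ltr0n.
have LM' : (L <= M)%N by lia.
pose Y (p : 'I_M) := z^* * W p.
pose G y := \sum_(l < L) g l * y ^+ l.
have b0 : 0 <= b := le_trans (cabs_ge0 _) (hb (Ordinal M_gt0)).
have E : \sum_(p < M) G (W p) * (dirichlet (2 * L) (Y p))^* * dirichlet L (Y p) = (M * L)%:R * G z.
  have Ep (p : 'I_M) : G (W p) * (dirichlet (2 * L) (Y p))^* * dirichlet L (Y p) =
      \sum_(l < L) \sum_(j < L) \sum_(i < 2 * L) g l * z ^+ l * (Y p ^+ (l + j) * (Y p)^* ^+ i).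
    rewrite /G -mulrA mulr_suml; apply: eq_bigr => l _.
    rewrite /dirichlet mulrA mulr_sumr; apply: eq_bigr => j _.
    rewrite rmorph_sum mulr_sumr mulr_suml; apply: eq_bigr => i _.
    rewrite /= conjcX exprD; have -> : W p = z * Y p by rewrite /Y mulrA unit_conj // mul1r.
    by rewrite exprMn; ring.
  rewrite (eq_bigr _ (fun p _ => Ep p)) exchange_big /= mulr_sumr.
  apply: eq_bigr => l _; rewrite exchange_big /= (eq_bigr (fun=> M%:R * (g l * z ^+ l))) => [|j _].
    by rewrite sumr_const card_ord -[LHS]mulr_natl natrM; ring.
  have lj : (l + j < 2 * L)%N by have := ltn_ord l; have := ltn_ord j; lia.
  rewrite exchange_big /= (bigD1 (Ordinal lj)) //= -mulr_sumr rotated_orthogonal ?eqxx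
    ?(leq_trans lj) //.
  rewrite big1 ?addr0 => [|k klj]; first by rewrite mulrC.
  rewrite -mulr_sumr rotated_orthogonal ?(leq_trans lj) ?(leq_trans (ltn_ord k)) //.
  by case: eqP => [h|]; rewrite ?mulr0 //; move: klj; rewrite -val_eqE /= -h eqxx.
have h1 := dirichlet_square_sum LM' z1.
have h2 := dirichlet_square_sum LM z1.
(* The mean of the two square sums [M L] and [2 M L] is the source of the factor 3/2. *)
have : (M * L)%:R * cabs (G z) <= b * (2^-1 * (M%:R * L%:R + M%:R * (2 * L)%:R)).
  rewrite -(cabs_nat R) -cabsM -E; apply: (le_trans (cabs_sum _ _ _)).
  rewrite -h1 -h2 -big_split !mulr_sumr; apply: ler_sum => p _ /=.
  rewrite -/(Y p) -mulrA cabsM; apply: ler_pM; rewrite ?cabs_ge0 ?hb //.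
  rewrite cabsM cabsJ; set c := cabs _; set d := cabs _; have := sqr_ge0 (c - d); nra.
rewrite !natrM -/(G z) => h3.
have ML : 0 < M%:R * L%:R :> R by rewrite mulr_gt0.
rewrite -(ler_pM2l ML); nra.
Qed.

End RootsOfUnity.

(** * The Jackson kernel: positivity, coefficients and decay *)

Section JacksonKernel.
Variable R : realType.
Implicit Types (z w y : R[i]) (x : R).

Definition jackson (m : nat) y : R := cabs (dirichlet m y) ^+ 4 / m%:R ^+ 4.

Lemma jackson_ge0 m y : 0 <= jackson m y.
Proof. by rewrite divr_ge0 ?exprn_ge0 ?cabs_ge0. Qed.

Lemma jackson_near m y : (0 < m)%N -> cabs y = 1 -> m%:R * cabs (y - 1) <= 2^-1 ->
  16^-1 <= jackson m y.
Proof.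
move=> m0 y1 h; have m0' : 0 < m%:R :> R by rewrite ltr0n.
rewrite /jackson ler_pdivlMr ?exprn_gt0 //.
have -> : 16^-1 * m%:R ^+ 4 = (m%:R / 2) ^+ 4 :> R by field.
by rewrite lerXn2r ?nnegrE ?divr_ge0 ?cabs_ge0 //; apply: dirichlet_near.
Qed.

Lemma sum_eq_ord_le1 m s : (\sum_(v < m) (v == s :> nat) <= 1)%N.
Proof.
case: (ltnP s m) => sm; last first.
  by rewrite big1 // => v _; case: eqP => // vs; have := ltn_ord v; rewrite vs ltnNge sm.
rewrite (bigD1 (Ordinal sm)) //= eqxx big1 // => v; rewrite -val_eqE /= => /negPf -> //.
Qed.

(** Writing the fourth power as [D^2 * conj (D^2)], the frequency [k] collects the quadruples of
    indices below [m] whose sums of pairs differ by [k] in absolute value. Three of the indices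
    leave at most two choices for the fourth, so there are at most [2 m^3] of them. *)
Lemma jackson_expansion m : (0 < m)%N -> exists g : nat -> R,
  (forall k, 0 <= g k <= 2 / m%:R) /\
  forall y, cabs y = 1 -> jackson m y = \sum_(k < 2 * m) g k * Re (y ^+ k).
Proof.
move=> m0; have m0' : 0 < m%:R :> R by rewrite ltr0n.
pose s (u : 'I_m * 'I_m) : nat := (u.1 + u.2)%N.
(* The absolute difference: one of the two truncated subtractions is always 0. Taking real parts
   merges opposite frequencies. *)
pose d u v : nat := ((s u - s v) + (s v - s u))%N.
pose cnt k : nat := (\sum_u \sum_v (d u v == k))%N.
have cnt_le k : (cnt k <= 2 * m ^ 3)%N.
  apply: (@leq_trans (\sum_(u : 'I_m * 'I_m) \sum_(v1 < m) 2)%N); last first.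
    by rewrite !sum_nat_const card_prod !card_ord; lia.
  apply: leq_sum => u _; rewrite -(pair_bigA _ (fun v1 v2 => (d u (v1, v2) == k) : nat)) /=.
  apply: leq_sum => v1 _.
  apply: (@leq_trans (\sum_(v2 < m) ((v2 == s u - v1 - k :> nat) + (v2 == s u + k - v1 :> nat)))%N).
    apply: leq_sum => v2 _; rewrite /d /s /=; lia.
  by rewrite big_split (leq_add (sum_eq_ord_le1 _ _) (sum_eq_ord_le1 _ _)).
have d_lt u v : (d u v < 2 * m)%N.
  by rewrite /d /s; have := ltn_ord u.1; have := ltn_ord u.2; have := ltn_ord v.1; have :=
    ltn_ord v.2; lia.
exists (fun k => (cnt k)%:R / m%:R ^+ 4); split=> [k|y y1].
  rewrite divr_ge0 ?exprn_ge0 //= ler_pdivrMr ?exprn_gt0 //.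
  have -> : 2 / m%:R * m%:R ^+ 4 = 2 * m%:R ^+ 3 :> R by field; rewrite gt_eqF.
  by rewrite -natrX -natrM ler_nat.
have -> : \sum_(k < 2 * m) (cnt k)%:R / m%:R ^+ 4 * Re (y ^+ k) = (\sum_u \sum_v Re (y ^+ (d u
  v))) / m%:R ^+ 4.
  transitivity (\sum_(k < 2 * m) \sum_u \sum_v (d u v == k)%:R * Re (y ^+ k) / m%:R ^+ 4).
    apply: eq_bigr => k _; rewrite natr_sum !mulr_suml; apply: eq_bigr => u _.
    by rewrite natr_sum !mulr_suml; apply: eq_bigr => v _; ring.
  rewrite exchange_big mulr_suml; apply: eq_bigr => u _.
  rewrite exchange_big mulr_suml; apply: eq_bigr => v _.
  rewrite (bigD1 (Ordinal (d_lt u v))) //= eqxx mul1r big1 ?addr0 // => k.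
  by rewrite -val_eqE eq_sym /= => /negPf ->; rewrite !mul0r.
rewrite /jackson; congr (_ / _).
have -> : cabs (dirichlet m y) ^+ 4 = Re (dirichlet m y ^+ 2 * (dirichlet m y ^+ 2)^*).
  by rewrite mul_conjc /= cabsX -exprM.
have -> : dirichlet m y ^+ 2 = \sum_u y ^+ s u.
  rewrite expr2 /dirichlet mulr_suml -(pair_bigA _ (fun i j : 'I_m => y ^+ (i + j))) /=.
  by apply: eq_bigr => i _; rewrite mulr_sumr; apply: eq_bigr => j _; rewrite exprD.
rewrite mulr_suml Re_sum; apply: eq_bigr => u _; rewrite rmorph_sum mulr_sumr Re_sum.
apply: eq_bigr => v _ /=; rewrite conjcX /d.
case: (leqP (s u) (s v)) => h.
  have -> : (s u - s v = 0)%N by lia.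
  rewrite add0n -{1}(subnK h) exprD mulrC -mulrA [y^* ^+ s u * _]mulrC unit_conjX // mulr1.
  by rewrite -conjcX ReJ.
have -> : (s v - s u = 0)%N by lia.
by rewrite addn0 -{1}(subnK (ltnW h)) exprD -mulrA unit_conjX // mulr1.
Qed.

Variables (M : nat) (zeta : R[i]).
Hypothesis zeta_prim : M.-primitive_root zeta.
Local Notation W p := (zeta ^+ p).

Lemma jackson_sum_le m z : (0 < m <= M)%N -> cabs z = 1 ->
  \sum_(p < M) jackson m (z^* * W p) <= M%:R / m%:R.
Proof.
case/andP=> m0 mM z1; have m0' : 0 < m%:R :> R by rewrite ltr0n.
rewrite -mulr_suml ler_pdivrMr ?exprn_gt0 //.
have -> : M%:R / m%:R * m%:R ^+ 4 = m%:R ^+ 2 * (M%:R * m%:R) :> R by field; rewrite gt_eqF.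
rewrite -(dirichlet_square_sum zeta_prim mM z1) mulr_sumr; apply: ler_sum => p _.
rewrite (exprD _ 2 2); apply: ler_wpM2r; first by rewrite exprn_ge0 ?cabs_ge0.
by rewrite lerXn2r ?nnegrE ?cabs_ge0 // dirichlet_le // (rotate_unit zeta_prim).
Qed.

(** Two of the four Dirichlet factors are at most [2 / r] beyond distance [r], and the other two are
    summed by Parseval. At [r] of order [100 / m] this makes the tail a small fraction of the
    peak. *)
Lemma jackson_sum_far_le m z (r : R) : (0 < m <= M)%N -> cabs z = 1 -> 0 < r ->
  \sum_(p < M | r <= cabs (z - W p)) jackson m (z^* * W p) <= 4 * M%:R / (m%:R ^+ 3 * r ^+ 2).
Proof.
case/andP=> m0 mM z1 r0; have m0' : 0 < m%:R :> R by rewrite ltr0n.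
rewrite -mulr_suml ler_pdivrMr ?exprn_gt0 //.
have -> : 4 * M%:R / (m%:R ^+ 3 * r ^+ 2) * m%:R ^+ 4 = (2 / r) ^+ 2 * (M%:R * m%:R) :> R.
  by field; rewrite !gt_eqF.
rewrite -(dirichlet_square_sum zeta_prim mM z1) mulr_sumr [leRHS](bigID (fun p : 'I_M =>
  r <= cabs (z - W p))) /=.
rewrite -[leLHS]addr0 lerD //; last first.
  by apply: sumr_ge0 => p _; rewrite mulr_ge0 ?exprn_ge0 ?cabs_ge0 ?divr_ge0 // ltW.
apply: ler_sum => p rp; rewrite (exprD _ 2 2); apply: ler_wpM2r;
  first by rewrite exprn_ge0 ?cabs_ge0.
rewrite lerXn2r ?nnegrE ?cabs_ge0 ?divr_ge0 ?(ltW r0) // ler_pdivlMr //.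
have := dirichlet_far m (rotate_unit zeta_prim p z1); rewrite cabs_mul_conj_sub //.
by apply: le_trans; apply: ler_wpM2l; rewrite ?cabs_ge0.
Qed.

End JacksonKernel.

(** * The cosine polynomial *)

Section RudinShapiro.
Variable R : realType.
Implicit Types (z w y : R[i]) (x : R).

Fixpoint rs_coef (t : nat) : (nat -> R) * (nat -> R) :=
  if t is t'.+1 then
    let: (p, q) := rs_coef t' in
    (fun k => if (k < 2 ^ t')%N then p k else q (k - 2 ^ t')%N,
     fun k => if (k < 2 ^ t')%N then p k else - q (k - 2 ^ t')%N)
  else (fun=> 1, fun=> 1).

Definition rsP t z := \sum_(k < 2 ^ t) ((rs_coef t).1 k)%:C * z ^+ k.
Definition rsQ t z := \sum_(k < 2 ^ t) ((rs_coef t).2 k)%:C * z ^+ k.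

Lemma rs_coef_sign t k :
  ((rs_coef t).1 k = 1 \/ (rs_coef t).1 k = -1) /\ ((rs_coef t).2 k = 1 \/ (rs_coef t).2 k = -1).
Proof.
elim: t k => [|t IH] k /=; first by split; left.
case: (rs_coef t) IH => p q /= IH; case: ifP => _; first by have [h _] := IH k.
by have [_ [->|->]] := IH (k - 2 ^ t)%N; split; rewrite ?opprK; [left|right|right|left].
Qed.

Lemma rs_rec t z : rsP t.+1 z = rsP t z + z ^+ (2 ^ t) * rsQ t z /\
                   rsQ t.+1 z = rsP t z - z ^+ (2 ^ t) * rsQ t z.
Proof.
have E : (2 ^ t.+1 = 2 ^ t + 2 ^ t)%N by rewrite expnS mul2n addnn.
rewrite /rsP /rsQ /=; case: (rs_coef t) => p q /=; rewrite E !big_split_ord /= mulr_sumr.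
split; congr (_ + _); try by (apply: eq_bigr => k _; rewrite ltn_ord).
  apply: eq_bigr => k _; rewrite ltnNge leq_addr /= addnC addnK exprD; ring.
rewrite -sumrN; apply: eq_bigr => k _; rewrite ltnNge leq_addr /= addnC addnK exprD rmorphN; ring.
Qed.

Lemma parallelogram z w : cabs (z + w) ^+ 2 + cabs (z - w) ^+ 2 = 2 * (cabs z ^+ 2 + cabs w ^+ 2).
Proof. by rewrite !cabs_sqr; case: z => a b; case: w => c d /=; ring. Qed.

Lemma rs_norm t z : cabs z = 1 -> cabs (rsP t z) ^+ 2 + cabs (rsQ t z) ^+ 2 = 2 * 2 ^+ t.
Proof.
move=> z1; elim: t => [|t IH].
  by rewrite /rsP /rsQ !big_ord1 expr0 !mulr1 /= cabs1 expr1n; ring.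
have [-> ->] := rs_rec t z.
by rewrite parallelogram cabsM cabsX z1 expr1n mul1r IH exprS.
Qed.

(** A Bernstein-type inequality obtained by running the recursion on differences. The increment of
    the second summand is at most [cabs Q + c], with [cabs Q <= c] by induction, and the
    parallelogram law turns [P^2 + (Q + c)^2 <= 4 c^2] into the required [8 c^2]. *)
Lemma rs_lipschitz t z w : cabs z = 1 -> cabs w = 1 ->
  cabs (rsP t z - rsP t w) ^+ 2 + cabs (rsQ t z - rsQ t w) ^+ 2
    <= (2 ^+ t * cabs (z - w)) ^+ 2 * (2 * 2 ^+ t).
Proof.
move=> z1 w1; elim: t => [|t IH].
  by rewrite /rsP /rsQ !big_ord1 !expr0 !subrr cabs0 expr0n addr0 mulr_ge0 ?sqr_ge0 ?expr0 ?mulr1.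
have [-> ->] := rs_rec t z; have [-> ->] := rs_rec t w.
set N := 2 ^+ t in IH *.
have N0 : 0 < N by rewrite exprn_gt0.
set P := rsP t z - _ in IH; set Q := rsQ t z - _ in IH.
set c := N * cabs (z - w) * Num.sqrt (2 * N).
have c0 : 0 <= c by rewrite !mulr_ge0 ?cabs_ge0 ?sqrtr_ge0 // ltW.
have c2 : (N * cabs (z - w)) ^+ 2 * (2 * N) = c ^+ 2.
  by rewrite [RHS]exprMn sqr_sqrtr // mulr_ge0 // ltW.
rewrite c2 in IH.
pose S := z ^+ (2 ^ t) * rsQ t z - w ^+ (2 ^ t) * rsQ t w.
have hS : cabs S <= cabs Q + c.
  have -> : S = w ^+ (2 ^ t) * Q + (z ^+ (2 ^ t) - w ^+ (2 ^ t)) * rsQ t z by rewrite /S /Q; ring.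
  apply: (le_trans (cabsD _ _)); rewrite !cabsM cabsX w1 expr1n mul1r lerD2l.
  apply: ler_pM; rewrite ?cabs_ge0 //.
    by apply: (le_trans (cabs_subX _ z1 w1)); rewrite natrX.
  rewrite -(@ler_pXn2r _ 2) ?nnegrE ?cabs_ge0 ?sqrtr_ge0 // (@sqr_sqrtr _ (2 * N)) ?mulr_ge0
    ?(ltW N0) //.
  by have := rs_norm t z1; rewrite -/N; have := sqr_ge0 (cabs (rsP t z)); lra.
have -> : rsP t z + z ^+ (2 ^ t) * rsQ t z - (rsP t w + w ^+ (2 ^ t) * rsQ t w) = P + S by
  rewrite /P /S; ring.
have -> : rsP t z - z ^+ (2 ^ t) * rsQ t z - (rsP t w - w ^+ (2 ^ t) * rsQ t w) = P - S by
  rewrite /P /S; ring.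
rewrite parallelogram [2 ^+ t.+1]exprS -/N.
have -> : (2 * N * cabs (z - w)) ^+ 2 * (2 * (2 * N)) = 8 * c ^+ 2 by rewrite -c2; ring.
have q0 := cabs_ge0 Q; have p0 := cabs_ge0 P; have s0 := cabs_ge0 S.
have : cabs S ^+ 2 <= (cabs Q + c) ^+ 2 by rewrite lerXn2r ?nnegrE ?addr_ge0.
have : cabs Q <= c by rewrite -(@ler_pXn2r _ 2) ?nnegrE // (le_trans _ IH) // lerDr sqr_ge0.
nra.
Qed.

(** At 1 the recursion is [(p, q) |-> (p + q, p - q)], whose square is multiplication by 2. Only at
    even indices are both values positive and equal. *)
Lemma rs_even_at1 u : rsP (2 * u) 1 = (2 ^+ u)%:C /\ rsQ (2 * u) 1 = (2 ^+ u)%:C.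
Proof.
elim: u => [|u [IHP IHQ]].
  by rewrite muln0 /rsP /rsQ !big_ord1 !expr0 !mulr1.
have -> : (2 * u.+1 = (2 * u).+2)%N by lia.
have [-> ->] := rs_rec (2 * u).+1 1; have [-> ->] := rs_rec (2 * u) 1.
by rewrite !expr1n !mul1r IHP IHQ exprS !rmorphM !rmorph_nat /=; split; ring.
Qed.

Lemma rs_even_bounds u z : cabs z = 1 ->
  [/\ cabs (rsP (2 * u) z) <= 2 * 2 ^+ u, cabs (rsQ (2 * u) z) <= 2 * 2 ^+ u &
      2 ^+ u <= cabs (rsP (2 * u) z) \/ 2 ^+ u <= cabs (rsQ (2 * u) z)].
Proof.
move=> z1; have := rs_norm (2 * u) z1.
have -> : 2 ^+ (2 * u) = (2 ^+ u) ^+ 2 :> R by rewrite mulnC exprM.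
set a := cabs _; set b := cabs _; set x : R := 2 ^+ u => h.
have a0 : 0 <= a := cabs_ge0 _; have b0 : 0 <= b := cabs_ge0 _.
have x0 : 0 < x by rewrite exprn_gt0.
have a2 := sqr_ge0 a; have b2 := sqr_ge0 b; have x2 := sqr_ge0 x.
split; first by rewrite -(@ler_pXn2r _ 2) ?nnegrE ?mulr_ge0 ?(ltW x0) //; lra.
  by rewrite -(@ler_pXn2r _ 2) ?nnegrE ?mulr_ge0 ?(ltW x0) //; lra.
case: (leP x a) => xa; first by left.
right; rewrite -(@ler_pXn2r _ 2) ?nnegrE ?(ltW x0) //; nra.
Qed.

Lemma rs_even_lipschitz u z w : cabs z = 1 -> cabs w = 1 ->
  cabs (rsP (2 * u) z - rsP (2 * u) w) <= 2 * (4 ^+ u * 2 ^+ u) * cabs (z - w) /\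
  cabs (rsQ (2 * u) z - rsQ (2 * u) w) <= 2 * (4 ^+ u * 2 ^+ u) * cabs (z - w).
Proof.
move=> z1 w1; have := rs_lipschitz (2 * u) z1 w1.
have -> : 2 ^+ (2 * u) = 4 ^+ u :> R by rewrite exprM; congr (_ ^+ _); ring.
have e4 : 4 ^+ u = 2 ^+ u ^+ 2 :> R by rewrite -exprM mulnC exprM; congr (_ ^+ _); ring.
set a := cabs _; set b := cabs _; set d := cabs _; set x : R := 2 ^+ u in e4 *; rewrite e4 => h.
have a0 : 0 <= a := cabs_ge0 _; have b0 : 0 <= b := cabs_ge0 _; have d0 : 0 <= d := cabs_ge0 _.
have x0 : 0 < x by rewrite exprn_gt0.
have X0 : 0 <= 2 * (x ^+ 2 * x) * d by rewrite !mulr_ge0 ?exprn_ge0 ?(ltW x0).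
have Z : (x ^+ 2 * d) ^+ 2 * (2 * x ^+ 2) <= (2 * (x ^+ 2 * x) * d) ^+ 2.
  have -> : (2 * (x ^+ 2 * x) * d) ^+ 2 = 2 * ((x ^+ 2 * d) ^+ 2 * (2 * x ^+ 2)) by ring.
  by rewrite ler_peMl ?mulr_ge0 ?sqr_ge0 //; lra.
have a2 := sqr_ge0 a; have b2 := sqr_ge0 b.
by split; rewrite -(@ler_pXn2r _ 2) ?nnegrE //; apply: le_trans Z; lra.
Qed.

End RudinShapiro.

(** * Lower bounds for the cosine polynomial: near 1, and by interpolation *)

Section CosinePolynomial.
Variable R : realType.
Implicit Types (z w y : R[i]) (x : R).

(** Newton interpolation, one node at a time: the quotient of [p - p.[y]] by ['X - y] is at most
    [2 d / s] at the other nodes. Recombining costs [d + 4 * E * d / s <= 5 / s * E * d], because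
    [E >= 1] and [s <= 1]. *)
Lemma interpolation_coef_bound (ys : seq R[i]) (s d : R) (p : {poly R[i]}) :
  0 < s <= 1 -> 0 <= d -> (size p <= size ys)%N -> all (fun y => cabs y == 1) ys ->
  pairwise (fun y y' => s <= cabs (y - y')) ys -> all (fun y => cabs p.[y] <= d) ys ->
  forall k, cabs p`_k <= (5 / s) ^+ size ys * d.
Proof.
case/andP=> s0 s1; elim: ys d p => [|y ys IH] d p d0 /=.
  by rewrite leqn0 size_poly_eq0 => /eqP -> _ _ _ k; rewrite coef0 cabs0 expr0 mul1r.
move=> sp /andP[/eqP y1 ys1] /andP[/allP sy pys] /andP[hy /allP hys].
have /factor_theorem[q pq] : root (p - p.[y]%:P) y by rewrite rootE !hornerE subrr.
have pE : p = q * ('X - y%:P) + p.[y]%:P by rewrite -pq subrK.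
have sq : (size q <= size ys)%N.
  case: (eqVneq q 0) => [->|q0]; first by rewrite size_poly0.
  have : size (q * ('X - y%:P)) = (size q).+1 by rewrite size_Mmonic ?monicXsubC // size_XsubC
    addn2.
  rewrite -pq -ltnS => <-; apply: (leq_trans (size_polyD _ _)).
  by rewrite geq_max sp size_polyN (leq_trans (size_polyC_leq1 _)).
have hq : all (fun y' => cabs q.[y'] <= 2 * d / s) ys.
  apply/allP => y' y'in; have := hys _ y'in; rewrite {1}pE !hornerE => h.
  have sy' := sy _ y'in; rewrite ler_pdivlMr //.
  apply: (@le_trans _ _ (cabs q.[y'] * cabs (y - y'))); first by rewrite ler_wpM2l ?cabs_ge0.
  rewrite cabsBC -cabsM; have := cabs_sub_ge (q.[y'] * (y' - y)) (- p.[y]).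
  by rewrite cabsN opprK; lra.
have dq0 : 0 <= 2 * d / s by rewrite divr_ge0 ?mulr_ge0 // ltW.
have {IH} IH := IH _ q dq0 sq ys1 pys hq.
set E := (5 / s) ^+ size ys in IH *.
have E5 : 1 <= E by apply: exprn_ege1; rewrite ler_pdivlMr //; lra.
move=> k; have -> : p`_k = (if k == 0%N then p.[y] else q`_k.-1) - y * q`_k + (if k == 0%N then 0
  else 0).
  rewrite {1}pE mulrBr coefD coefB coefMX mulrC coefCM coefC; case: k => [|k] /=; ring.
rewrite if_same addr0; apply: (le_trans (cabsB _ _)); rewrite cabsM y1 mul1r.
have h1 := IH k.
have : cabs (if k == 0%N then p.[y] else q`_k.-1) <= d + E * (2 * d / s).
  case: k h1 => [|k] h1 /=; last by apply: (le_trans (IH k)); lra.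
  by apply: (le_trans hy); rewrite lerDl mulr_ge0 // ltW //; lra.
rewrite exprS -/E.
have -> : 5 / s * E * d = 2 * (E * (2 * d / s)) + E * d / s by field; rewrite gt_eqF.
suff : d <= E * d / s by lra.
by rewrite ler_pdivlMr //; nra.
Qed.

Variables u T : nat.
Hypothesis uT : (2 ^ (2 * u) <= T)%N.

Let T_gt0 : (0 < T)%N := leq_trans (expn_gt0 2 (2 * u)) uT.

Definition cosine_coef (k : nat) : R :=
  \sum_(i < 2 ^ (2 * u)) ((rs_coef R (2 * u)).1 i *+ (k == 2 * (T + i))%N
                        + (rs_coef R (2 * u)).2 i *+ (k == 2 * (2 * T + i))%N).

Lemma cosine_coef_odd k : odd k -> cosine_coef k = 0.
Proof.
move=> ok; rewrite /cosine_coef big1 // => i _.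
have -> : (k == 2 * (T + i))%N = false by apply/eqP => kE; move: ok; rewrite kE mul2n odd_double.
have -> : (k == 2 * (2 * T + i))%N = false by apply/eqP => kE; move: ok;
  rewrite kE mul2n odd_double.
by rewrite !mulr0n addr0.
Qed.

Lemma cosine_coef0 : cosine_coef 0 = 0.
Proof.
rewrite /cosine_coef big1 // => i _.
have -> : (0 == 2 * (T + i))%N = false by have := T_gt0; lia.
have -> : (0 == 2 * (2 * T + i))%N = false by have := T_gt0; lia.
by rewrite !mulr0n addr0.
Qed.

(** The even frequencies used by the two blocks lie in [[2T, 4T)] and [[4T, 6T)], which are disjoint
    because [2 ^ (2 * u) <= T]; at most one term of the defining sum survives. *)
Lemma cosine_coef_sign k : [\/ cosine_coef k = 0, cosine_coef k = 1 | cosine_coef k = -1].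
Proof.
case: (boolP [exists i : 'I_(2 ^ (2 * u)), (k == 2 * (T + i)) || (k == 2 * (2 * T + i))]%N) =>
  [/existsP[i hi]|no].
  have ltNT := uT; rewrite /cosine_coef (bigD1 i) //= big1 ?addr0 => [|j ji].
    have [h1 h2] := rs_coef_sign R (2 * u) i; have li := ltn_ord i.
    case/orP: hi => /eqP ->.
      rewrite eqxx; have -> : (2 * (T + i) == 2 * (2 * T + i))%N = false by lia.
      by rewrite mulr0n mulr1n addr0; case: h1 => ->; [apply: Or32|apply: Or33].
    rewrite eqxx; have -> : (2 * (2 * T + i) == 2 * (T + i))%N = false by lia.
    by rewrite mulr0n mulr1n add0r; case: h2 => ->; [apply: Or32|apply: Or33].
  have li := ltn_ord i; have lj := ltn_ord j.
  have nij : (j : nat) <> i by move=> h; case/eqP: ji; apply: val_inj.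
  have -> : (k == 2 * (T + j))%N = false by case/orP: hi => /eqP ->; lia.
  have -> : (k == 2 * (2 * T + j))%N = false by case/orP: hi => /eqP ->; lia.
  by rewrite !mulr0n addr0.
apply: Or31; rewrite /cosine_coef big1 // => i _; move: no; rewrite negb_exists => /forallP/(_ i).
by rewrite negb_or => /andP[/negPf -> /negPf ->]; rewrite !mulr0n addr0.
Qed.

Definition cosineP z : R :=
  1 + 2 * Re (z ^+ (2 * T) * rsP (2 * u) (z ^+ 2) + z ^+ (4 * T) * rsQ (2 * u) (z ^+ 2)).

Lemma cosine_expansion h z : (6 * T <= h)%N ->
  cosineP z = 1 + 2 * \sum_(k < h.+1) cosine_coef k * Re (z ^+ k).
Proof.
move=> hT; rewrite /cosineP; congr (_ + 2 * _).
have -> : \sum_(k < h.+1) cosine_coef k * Re (z ^+ k) =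
   \sum_(i < 2 ^ (2 * u)) ((rs_coef R (2 * u)).1 i * Re (z ^+ (2 * (T + i))) + (rs_coef R (2 *
     u)).2 i * Re (z ^+ (2 * (2 * T + i)))).
  under eq_bigr => k _ do rewrite mulr_suml.
  rewrite exchange_big; apply: eq_bigr => i _ /=; have li := ltn_ord i; have ltNT := uT.
  under eq_bigr => k _ do rewrite mulrDl !mulrnAl.
  have pick n (f : nat -> R) : (n < h.+1)%N -> \sum_(k < h.+1) f k *+ (k == n :> nat) = f n.
    move=> nh; rewrite (bigD1 (Ordinal nh)) //= eqxx mulr1n big1 ?addr0 // => k.
    by rewrite -val_eqE /= => /negPf ->; rewrite mulr0n.
  by rewrite big_split /= (pick _ (fun k => _ * Re (z ^+ k))) ?(pick _ (fun k =>
    _ * Re (z ^+ k))) //; lia.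
rewrite /rsP /rsQ !mulr_sumr -big_split Re_sum; apply: eq_bigr => i _ /=.
have -> : z ^+ (2 * T) * (((rs_coef R (2 * u)).1 i)%:C * z ^+ 2 ^+ i) = ((rs_coef R (2 * u)).1
  i)%:C * z ^+ (2 * (T + i)).
  by rewrite -exprM mulrCA -exprD mulnDr.
have -> : z ^+ (4 * T) * (((rs_coef R (2 * u)).2 i)%:C * z ^+ 2 ^+ i) = ((rs_coef R (2 * u)).2
  i)%:C * z ^+ (2 * (2 * T + i)).
  by rewrite -exprM mulrCA -exprD mulnDr mulnA.
by rewrite ReD !ReZ.
Qed.

Lemma cosinePJ z : cosineP z^* = cosineP z.
Proof.
by rewrite !(@cosine_expansion (6 * T)) //; congr (_ + 2 * _); apply: eq_bigr => k _;
  rewrite -conjcX ReJ.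
Qed.

Lemma cosinePN z : cosineP (- z) = cosineP z.
Proof.
rewrite /cosineP sqrrN; have E n : (- z) ^+ (2 * n) = z ^+ (2 * n) by rewrite !exprM sqrrN.
have T4 : (4 * T = 2 * (2 * T))%N by lia.
by rewrite T4 !E.
Qed.

Lemma cosineP_le z : cabs z = 1 -> `|cosineP z| <= 1 + 8 * 2 ^+ u.
Proof.
move=> z1; have z21 : cabs (z ^+ 2) = 1 by rewrite cabsX z1 expr1n.
have [hP hQ _] := rs_even_bounds u z21.
apply: (le_trans (ler_normD _ _)); rewrite normr1 lerD2l normrM ger0_norm //.
have -> : 8 * 2 ^+ u = 2 * (2 * 2 ^+ u + 2 * 2 ^+ u) :> R by ring.
rewrite ler_pM2l // (le_trans (Re_le_cabs _)) // (le_trans (cabsD _ _)) //.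
by rewrite !cabsM !cabsX z1 !expr1n !mul1r lerD.
Qed.

Let N_le : 4 ^+ u <= T%:R :> R.
Proof.
have -> : 4 ^+ u = (2 ^ (2 * u))%:R :> R by rewrite natrX exprM; congr (_ ^+ _); ring.
by rewrite ler_nat.
Qed.

(** This keeps the bad points away from 1, where no sine polynomial can help. The value at 1 is
    [1 + 4 * 2 ^+ u], and at distance [1 / (100 T)] each of the two terms has moved by at most 12
    percent of [2 ^+ u]. *)
Lemma cosineP_near1 z : cabs z = 1 -> cabs (z - 1) <= (100 * T%:R)^-1 -> 2 * 2 ^+ u < cosineP z.
Proof.
move=> z1 hz; have z21 : cabs (z ^+ 2) = 1 by rewrite cabsX z1 expr1n.
have T0 : 0 < T%:R :> R by rewrite ltr0n.
have [hP hQ _] := rs_even_bounds u z21.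
have [lP lQ] := rs_even_lipschitz u z21 (cabs1 R); have [eP eQ] := rs_even_at1 R u.
rewrite eP in lP; rewrite eQ in lQ.
set x := 2 ^+ u in hP hQ lP lQ *; have x0 : 0 < x by rewrite exprn_gt0.
set d := cabs (z - 1) in hz; have d0 : 0 <= d := cabs_ge0 _.
have Td : T%:R * d <= 100^-1.
  by apply: (le_trans (ler_wpM2l (ltW T0) hz)); rewrite invfM mulrCA divff ?gt_eqF // mulr1.
have d2 : cabs (z ^+ 2 - 1) <= 2 * d.
  by have := cabs_subX 2 z1 (cabs1 R); rewrite expr1n.
have lip : 2 * (4 ^+ u * x) * cabs (z ^+ 2 - 1) <= 4 / 100 * x.
  have h2 : 0 <= cabs (z ^+ 2 - 1) := cabs_ge0 _.
  have h4 : 4 ^+ u * cabs (z ^+ 2 - 1) <= T%:R * (2 * d) by apply: ler_pM => //; rewrite exprn_ge0.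
  nra.
have term n (F : R[i]) : n%:R * d <= 4 / 100 -> cabs F <= 2 * x -> cabs (F - x%:C) <= 4 / 100 * x ->
   cabs (z ^+ n * F - x%:C) <= 12 / 100 * x.
  move=> hn hF hFx; have -> : z ^+ n * F - x%:C = (z ^+ n - 1) * F + (F - x%:C) by ring.
  apply: (le_trans (cabsD _ _)); rewrite cabsM.
  have : cabs (z ^+ n - 1) <= 4 / 100.
    by apply: le_trans hn; have := cabs_subX n z1 (cabs1 R); rewrite expr1n.
  have := cabs_ge0 (z ^+ n - 1); have := cabs_ge0 F; nra.
have h1 := term (2 * T)%N _ _ hP (le_trans lP lip).
have h2 := term (4 * T)%N _ _ hQ (le_trans lQ lip).
rewrite !natrM in h1 h2.
have {}h1 := h1 ltac:(lra); have {}h2 := h2 ltac:(lra).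
rewrite /cosineP; set A := _ * rsP _ _ in h1 *; set B := _ * rsQ _ _ in h2 *.
have r1 := le_trans (Re_le_cabs _) h1; have r2 := le_trans (Re_le_cabs _) h2.
move: r1 r2; rewrite !ler_norml; case: A h1 => a b _; case: B h2 => a' b' _ /=.
by move=> /andP[r1 _] /andP[r2 _]; lra.
Qed.

(** For nearby points, [z^(2n) - w^(2n)] is, up to a unit factor, the difference times a Dirichlet
    kernel near its peak, hence of modulus at least [n]. So distinct bad points give separated
    interpolation nodes. *)
Lemma power_separation n z w : cabs z = 1 -> cabs w = 1 -> (2 * n)%:R * cabs (z - w) <= 2^-1 ->
  n%:R * cabs (z - w) <= cabs (z ^+ (2 * n) - w ^+ (2 * n)).
Proof.
move=> z1 w1 h; have y1 : cabs (z^* * w) = 1 by rewrite cabsM cabsJ z1 mul1r.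
have -> : cabs (z ^+ (2 * n) - w ^+ (2 * n)) = cabs ((z^* * w) ^+ (2 * n) - 1).
  rewrite -[LHS]mul1r -[in LHS](expr1n _ (2 * n)) -z1 -cabsJ -cabsX -cabsM mulrBr exprMn cabsBC.
  by rewrite [z^* ^+ _ * z ^+ _]mulrC unit_conjX.
rewrite subrX1 cabsM cabs_mul_conj_sub // mulrC; apply: ler_wpM2l; first exact: cabs_ge0.
have := dirichlet_near (a := 2 * n) y1; rewrite cabs_mul_conj_sub // => /(_ h).
by apply: le_trans; rewrite natrM; lra.
Qed.

(* [rsP] and [rsQ] are almost constant near [z0], so [y^2 * cosineP z] is close to a
   polynomial of degree 4 in [y = z^(2T)], which interpolation at 5 points bounds. *)
Lemma small_cosine_points (kappa s : R) (zs : seq R[i]) :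
  0 <= kappa -> 0 < s <= 1 ->
  (5 / s) ^+ 5 * (kappa + 4 * 4 ^+ u / T%:R) < 1 ->
  size zs = 5%N -> (forall z, z \in zs -> cabs z = 1 /\ `|cosineP z| <= kappa * 2 ^+ u) ->
  pairwise (fun z w => s <= T%:R * cabs (z - w)) zs ->
  ~ (forall z w, z \in zs -> w \in zs -> 4 * T%:R * cabs (z - w) <= 1).
Proof.
move=> k0 s01 small sz hz sep near.
have T4 : (4 * T = 2 * T * 2)%N by rewrite mulnAC.
have T0 : 0 < T%:R :> R by rewrite ltr0n.
case: zs sz => // z0 zs sz in hz sep near *.
have z0in : z0 \in z0 :: zs by rewrite mem_head.
have [z01 _] := hz z0 z0in.
have z021 : cabs (z0 ^+ 2) = 1 by rewrite cabsX z01 expr1n.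
pose a := rsP (2 * u) (z0 ^+ 2); pose b := rsQ (2 * u) (z0 ^+ 2).
pose p : {poly R[i]} := Poly [:: b^*; a^*; 1; a; b].
pose x : R := 2 ^+ u; have x0 : 0 < x by rewrite exprn_gt0.
pose ys := [seq z ^+ (2 * T) | z <- z0 :: zs].
have sp : (size p <= size ys)%N by rewrite size_map sz (leq_trans (size_Poly _)).
have bound : all (fun y => cabs p.[y] <= (kappa + 4 * 4 ^+ u / T%:R) * x) ys.
  apply/allP => _ /mapP[z zin ->]; have [z1 hc] := hz z zin.
  set y := z ^+ (2 * T); have y1 : cabs y = 1 by rewrite cabsX z1 expr1n.
  have pE : p.[y] = y ^+ 2 * (1 + 2 * Re (y * a + y ^+ 2 * b))%:C.
    have yy := unit_conj y1.
    rewrite /p horner_Poly /= mul0r add0r.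
    have -> : (1 + 2 * Re (y * a + y ^+ 2 * b))%:C = 1 + (y * a + y ^+ 2 * b) + (y * a + y ^+ 2 *
      b)^*.
      by rewrite -addrA addcJ rmorphD rmorphM rmorph1 rmorph_nat.
    rewrite rmorphD !rmorphM /=.
    have -> : y ^+ 2 * (1 + (y * a + y ^+ 2 * b) + (y^* * a^* + y^* * y^* * b^*))
      = y ^+ 2 + y ^+ 3 * a + y ^+ 4 * b + (y * y^*) * y * a^* + (y * y^*) ^+ 2 * b^* by ring.
    rewrite yy; ring.
  rewrite pE cabsM cabsX y1 expr1n mul1r cabs_real.
  have z21 : cabs (z ^+ 2) = 1 by rewrite cabsX z1 expr1n.
  have [lP lQ] := rs_even_lipschitz u z21 z021.
  have d2 : cabs (z ^+ 2 - z0 ^+ 2) <= 2 * cabs (z - z0) := cabs_subX 2 z1 z01.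
  have d1 : cabs (z - z0) <= (4 * T%:R)^-1.
    by rewrite -[leRHS]mul1r ler_pdivlMr ?mulr_gt0 // mulrC; apply: near.
  set err := 2 * (4 ^+ u * 2 ^+ u) * cabs (z ^+ 2 - z0 ^+ 2) in lP lQ.
  have err_le : 4 * err <= 4 * 4 ^+ u / T%:R * x.
    have -> : 4 * 4 ^+ u / T%:R * x = 4 * (2 * (4 ^+ u * 2 ^+ u) * (2 * (4 * T%:R)^-1)).
      by rewrite /x; field; rewrite gt_eqF.
    rewrite ler_pM2l // /err; apply: ler_wpM2l; first by rewrite !mulr_ge0 ?exprn_ge0.
    by apply: (le_trans d2); rewrite ler_pM2l.
  have -> : 1 + 2 * Re (y * a + y ^+ 2 * b) = cosineP z - 2 * Re (y * (rsP (2 * u) (z ^+ 2) - a)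
    + y ^+ 2 * (rsQ (2 * u) (z ^+ 2) - b)).
    have y2 : z ^+ (4 * T) = y ^+ 2 by rewrite T4 exprM.
    rewrite /cosineP y2 -/y; move: (rsP _ (z ^+ 2)) (rsQ _ (z ^+ 2)) => A B.
    have -> : y * (A - a) + y ^+ 2 * (B - b) = y * A + y ^+ 2 * B - (y * a + y ^+ 2 * b) by ring.
    by rewrite ReB; ring.
  apply: (le_trans (ler_normB _ _)); rewrite [leRHS]mulrDl; apply: lerD => //.
  rewrite normrM ger0_norm //; apply: le_trans err_le.
  have -> : 4 * err = 2 * (err + err) by ring.
  rewrite ler_pM2l // (le_trans (Re_le_cabs _)) // (le_trans (cabsD _ _)) //.
  by rewrite !cabsM !cabsX ?y1 ?z1 !expr1n !mul1r lerD.
have units : all (fun y => cabs y == 1) ys.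
  by apply/allP => _ /mapP[z zin ->]; have [z1 _] := hz z zin; rewrite cabsX z1 expr1n.
have seps : pairwise (fun y y' => s <= cabs (y - y')) ys.
  rewrite pairwise_map; apply: (sub_in_pairwise _ (allss (z0 :: zs)) sep) => z w zin win h.
  have [z1 _] := hz _ zin; have [w1 _] := hz _ win.
  apply: (le_trans h); apply: power_separation => //.
  by have := near _ _ zin win; rewrite natrM; lra.
have coef := interpolation_coef_bound s01 (mulr_ge0 _ (ltW x0)) sp units seps bound.
have nonneg : 0 <= kappa + 4 * 4 ^+ u / T%:R by rewrite addr_ge0 // divr_ge0 ?mulr_ge0 ?exprn_ge0.
have {}coef := coef nonneg; rewrite size_map sz mulrA in coef.
(* The coefficients of degrees 3 and 4 are the Rudin-Shapiro values [a] and [b] at [z0 ^+ 2], which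
   cannot both be below [2 ^+ u]. *)
have lt1 k : cabs p`_k < x.
  by apply: (le_lt_trans (coef k)); rewrite -[ltRHS]mul1r ltr_pM2r.
have [_ _] := rs_even_bounds u z021; rewrite -/a -/b -/x.
have := lt1 3%N; have := lt1 4%N; rewrite !coef_Poly /=; case=> *; lra.
Qed.

End CosinePolynomial.

(** * The sine polynomial *)

Section SineTarget.
Variable R : realType.
Implicit Types (z w y : R[i]) (x : R).
Variables (m T a : nat) (zeta : R[i]) (bad : R[i] -> Prop).
Hypothesis a_gt0 : (0 < a)%N.
(* The packing radius [1 / (2a)] is then [808 / m], the diameter of a cluster. *)
Hypothesis m_eq : m = (1616 * a)%N.
Hypothesis T_gt0 : (0 < T)%N.
Hypothesis T_le : (201 * 100 * T <= m)%N.
Hypothesis zeta_prim : (16 * m).-primitive_root zeta.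
Local Notation M := (16 * m)%N.
Local Notation W p := (zeta ^+ p).

Hypothesis bad_unit : forall z, bad z -> cabs z = 1.
Hypothesis badJ : forall z, bad z -> bad z^*.
Hypothesis badN : forall z, bad z -> bad (- z).
Hypothesis bad_far1 : forall z, bad z -> (100 * T%:R)^-1 < cabs (z - 1).
Hypothesis bad_sparse : forall zs : seq R[i], size zs = 5%N -> {in zs, forall z, bad z} ->
  pairwise (fun z w => 100 / m%:R <= cabs (z - w)) zs ->
  ~ {in zs &, forall z w, cabs (z - w) <= (4 * T%:R)^-1}.

Let m_gt0 : (0 < m)%N. Proof. by rewrite m_eq muln_gt0. Qed.
Let mR_gt0 : 0 < m%:R :> R. Proof. by rewrite ltr0n. Qed.
Let mi_gt0 : 0 < m%:R^-1 :> R. Proof. by rewrite invr_gt0. Qed.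
Let TR_gt0 : 0 < T%:R :> R. Proof. by rewrite ltr0n. Qed.
Let T_leR : 201 * 100 * T%:R <= m%:R :> R. Proof. by rewrite -!natrM ler_nat. Qed.
Let T_le2m : (512 * T <= 2 * m)%N.
Proof.
apply: leq_trans (leq_pmull m _) => //; apply: leq_trans T_le.
by rewrite leq_mul2r orbT.
Qed.
Let W_unit p : cabs (W p) = 1 := prim_rootX_unit zeta_prim p.
(** The required separation [100 / m] of bad points, plus the error [1 / (2 m)] made at both ends
    when bad points are replaced by roots of unity. *)
Let rho : R := 101 / m%:R.
Let rho_gt0 : 0 < rho. Proof. by rewrite divr_gt0. Qed.
Let inv_mT : 201 * 100 * m%:R^-1 <= T%:R^-1 :> R.
Proof.
have mi : 0 < m%:R^-1 :> R by rewrite invr_gt0.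
by rewrite -[leRHS]mul1r ler_pdivlMr // mulrAC ler_pdivrMr // mul1r.
Qed.

(** Bad points enter only through nearby roots of unity, a finite set. The first quadrant suffices,
    since the symmetries of the sine sum carry its lower bound to the other three. *)
Definition bad_roots : {set 'I_M} :=
  [set p : 'I_M | [&& `[< exists z, bad z /\ cabs (z - W p) <= (2 * m%:R)^-1 >],
                      0 <= Re (W p) & 0 <= Im (W p)]].
Local Notation Q := bad_roots.

Lemma bad_root_witness : exists wit : 'I_M -> R[i],
  forall p, p \in Q -> bad (wit p) /\ cabs (wit p - W p) <= (2 * m%:R)^-1.
Proof.
suff [f hf] : {f : 'I_M -> R[i] & forall p, p \in Q -> bad (f p) /\
  cabs (f p - W p) <= (2 * m%:R)^-1}.
  by exists f.
apply: (@choice _ _ (fun (p : 'I_M) z => p \in Q -> bad z /\ cabs (z - W p) <= (2 * m%:R)^-1)) => p.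
case: (boolP (p \in Q)) => [|_]; last by exists 0.
by rewrite inE => /and3P[/asboolP[z hz] _ _]; exists z.
Qed.

Definition near_rel : rel 'I_M :=
  [rel p q | [&& p \in Q, q \in Q & cabs (W p - W q) < rho]].

Lemma near_sym : connect_sym near_rel.
Proof. by apply: sym_connect_sym => p q; rewrite /near_rel /= cabsBC andbCA. Qed.

Lemma near_connect_Q p q : p \in Q -> connect near_rel p q -> q \in Q.
Proof.
move=> pQ pq; have cl : closed near_rel (mem Q) by move=> r s /= /and3P[-> ->].
by rewrite -(closed_connect cl pq).
Qed.

Lemma witness_sep (wit : 'I_M -> R[i]) p q :
  (forall p, p \in Q -> bad (wit p) /\ cabs (wit p - W p) <= (2 * m%:R)^-1) ->
  p \in Q -> q \in Q -> rho <= cabs (W p - W q) -> 100 / m%:R <= cabs (wit p - wit q).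
Proof.
move=> hw pQ qQ h; have [_ hp] := hw _ pQ; have [_ hq] := hw _ qQ.
have := cabs_dist (W p) (wit p) (W q); have := cabs_dist (wit p) (wit q) (W q).
rewrite (cabsBC (W p) (wit p)) => h1 h2; rewrite /rho in h; rewrite invfM in hp hq; lra.
Qed.

(** A component reaching distance [8 * rho] from [p] would meet the annuli starting at [2], [4], [6]
    and [8] times [rho]. With [p] itself this yields five separated bad points on one short arc,
    against [bad_sparse]. *)
Lemma component_diam p q : p \in Q -> connect near_rel p q -> cabs (W q - W p) < 8 * rho.
Proof.
move=> pQ pq; rewrite ltNge; apply/negP => far.
(* A chain of steps shorter than [rho] cannot jump over an annulus of width [rho]. *)
have step x : 0 < x -> x <= 8 * rho -> exists r : 'I_M, [/\ r \in Q,
  x <= cabs (W r - W p) & cabs (W r - W p) < x + rho].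
  move=> x0 x8; apply: contrapT => no.
  have cl : closed near_rel [pred r : 'I_M | cabs (W r - W p) < x].
    apply: (intro_closed near_sym) => r s /and3P[rQ sQ rs] /=; rewrite !inE => rx.
    rewrite ltNge; apply/negP => xs; apply: no; exists s; split=> //.
    by apply: (le_lt_trans (cabs_dist _ (W r) _)); rewrite cabsBC; lra.
  have := closed_connect cl pq; rewrite !inE subrr cabs0 x0 => /esym; lra.
have [wit hw] := bad_root_witness.
have r0 := rho_gt0.
have [q1 [q1Q a1 b1]] := step (2 * rho) ltac:(lra) ltac:(lra).
have [q2 [q2Q a2 b2]] := step (4 * rho) ltac:(lra) ltac:(lra).
have [q3 [q3Q a3 b3]] := step (6 * rho) ltac:(lra) ltac:(lra).
have [q4 [q4Q a4 b4]] := step (8 * rho) ltac:(lra) ltac:(lra).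
have sep (r s : 'I_M) : r \in Q -> s \in Q -> cabs (W r - W p) + rho <= cabs (W s - W p) ->
  100 / m%:R <= cabs (wit r - wit s).
  move=> rQ sQ h; apply: witness_sep => //; have := cabs_dist (W s) (W r) (W p).
  by rewrite (cabsBC (W s) (W r)); lra.
have pp : cabs (W p - W p) = 0 by rewrite subrr cabs0.
have ub (r s : 'I_M) : r \in Q -> s \in Q -> cabs (W r - W p) < 9 * rho ->
  cabs (W s - W p) < 9 * rho ->
    cabs (wit r - wit s) <= (4 * T%:R)^-1.
  move=> rQ sQ hr hs; have [_ h1] := hw _ rQ; have [_ h2] := hw _ sQ.
  have := cabs_dist (wit r) (W r) (wit s); have := cabs_dist (W r) (W s) (wit s); have :=
    cabs_dist (W r) (W p) (W s).
  rewrite (cabsBC (W p) (W s)) (cabsBC (W s) (wit s)) => h3 h4 h5.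
  have := inv_mT; have : 0 < m%:R^-1 :> R by rewrite invr_gt0.
  rewrite invfM in h1 h2; rewrite /rho in hr hs; rewrite invfM; lra.
apply: (@bad_sparse [:: wit p; wit q1; wit q2; wit q3; wit q4]) => //.
- by move=> z; rewrite !inE => /or4P[/eqP->|/eqP->|/eqP->|/orP[]/eqP->];
  [case: (hw p)|case: (hw q1)|case: (hw q2)|case: (hw q3)|case: (hw q4)].
- by clear -sep q1Q q2Q q3Q q4Q pQ a1 a2 a3 a4 b1 b2 b3 b4 r0 pp; rewrite /= !andbT;
  do !(apply/andP; split); apply: sep => //; lra.
have mem z : z \in [:: wit p; wit q1; wit q2; wit q3; wit q4] -> exists r : 'I_M, [/\ z = wit r,
  r \in Q & cabs (W r - W p) < 9 * rho].
  by rewrite !inE => /or4P[/eqP->|/eqP->|/eqP->|/orP[]/eqP->];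
    [exists p|exists q1|exists q2|exists q3|exists q4]; split=> //; lra.
by move=> z w /mem[r [-> rQ hr]] /mem[s [-> sQ hs]]; apply: ub.
Qed.

Lemma component_card p : p \in Q ->
  (#|[set q in Q | fingraph.root near_rel q == fingraph.root near_rel p]| <= 64 * 1616)%N.
Proof.
move=> pQ; have aM : (0 < a <= M)%N by rewrite a_gt0 m_eq; lia.
have ar : a%:R * (8 * rho) <= 2^-1.
  have -> : a%:R * (8 * rho) = 808 * a%:R / m%:R by rewrite /rho; ring.
  by rewrite ler_pdivrMr // m_eq natrM; lra.
have hS := roots_packing zeta_prim aM (W_unit p) ar; set S := [set _ | _] in hS.
have : (#|[set q in Q | fingraph.root near_rel q == fingraph.root near_rel p]| <= #|S|)%N.
  apply: subset_leq_card; apply/subsetP => q; rewrite !inE => /andP[qQ].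
  rewrite (root_connect near_sym) near_sym => pq.
  by rewrite cabsBC; apply: ltW; apply: component_diam => //; rewrite inE.
have : (#|S| * a <= (64 * 1616) * a)%N by apply: (leq_trans hS); rewrite m_eq !mulnA.
by rewrite leq_pmul2r // => h1 h2; apply: leq_trans h2 h1.
Qed.

Definition component_reps : {set 'I_M} := [set p in Q | fingraph.root near_rel p == p].

(** The [128 * T] roots of unity of that order come within [1 / (16 T)] of every point of the
    circle. Representatives of distinct components are at least [rho] apart, so [bad_sparse] allows
    at most four around each of these roots. *)
Lemma component_reps_card : (#|component_reps| <= 512 * T)%N.
Proof.
have [xi xi_prim] := prim_root_exists R (M := 128 * T) ltac:(lia).
have [wit hw] := bad_root_witness.
pose S (g : 'I_(128 * T)) := [set p in component_reps | cabs (W p - xi ^+ g) <= 4 / (64 * T)%:R].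
have S4 g : (#|S g| <= 4)%N.
  rewrite leqNgt; apply/negP => /card_geqP[s [us s5 sS]].
  have sQ p : p \in s -> [/\ p \in Q,
    fingraph.root near_rel p = p & cabs (W p - xi ^+ g) <= 4 / (64 * T)%:R].
    by move/sS; rewrite !inE => /andP[/andP[-> /eqP ->] ->].
  apply: (@bad_sparse (map wit s)); first by rewrite size_map.
  - by move=> _ /mapP[p /sQ[pQ _ _] ->]; case: (hw p pQ).
  - rewrite pairwise_map; move: us; rewrite uniq_pairwise.
    apply: (sub_in_pairwise _ (allss s)) => p q ps qs /= pq.
    have [pQ rp _] := sQ _ ps; have [qQ rq _] := sQ _ qs.
    apply: witness_sep => //; rewrite leNgt; apply: contra pq => lt.
    rewrite -rp -rq (root_connect near_sym); apply: connect1.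
    by rewrite /near_rel /= pQ qQ lt.
  move=> _ _ /mapP[p /sQ[pQ _ hp] ->] /mapP[q /sQ[qQ _ hq] ->].
  have [_ h1] := hw _ pQ; have [_ h2] := hw _ qQ.
  have := cabs_dist (wit p) (W p) (wit q); have := cabs_dist (W p) (W q) (wit q); have :=
    cabs_dist (W p) (xi ^+ g) (W q).
  rewrite (cabsBC (xi ^+ g) (W q)) (cabsBC (W q) (wit q)) => h3 h4 h5.
  have := inv_mT; have : 0 < m%:R^-1 :> R by rewrite invr_gt0.
  rewrite natrM invfM in hp hq; rewrite invfM in h1 h2; rewrite invfM; lra.
have cover p : p \in component_reps -> (1 <= \sum_g (p \in S g))%N.
  move=> pR; have T64 : (0 < 64 * T)%N by rewrite muln_gt0.
  have T128 : (2 * (64 * T) <= 128 * T)%N by rewrite mulnA.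
  have [g hg] := roots_cover xi_prim T64 T128 (W_unit p).
  by rewrite (bigD1 g) //= inE pR hg.
rewrite -sum1_card; apply: (@leq_trans (\sum_(p in component_reps) \sum_g (p \in S g))%N).
  exact: leq_sum.
rewrite exchange_big /=; apply: (@leq_trans (\sum_(g < 128 * T) 4)%N); last first.
  by rewrite sum_nat_const card_ord mulnAC.
apply: leq_sum => g _; apply: leq_trans (S4 g); rewrite -sum1_card big_mkcond [leqRHS]big_mkcond /=.
by apply: leq_sum => p _; case: (p \in component_reps); case: (p \in S g).
Qed.

(** In the first quadrant the distance to 1 is at most [2 * Im], and bad points stay
    [1 / (100 T) >= 201 / m] away from 1. The mirror image in the real axis is therefore far away,
    so its negative kernel does not cancel the main one. *)
Lemma bad_root_Im p : p \in Q -> 100 / m%:R <= Im (W p).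
Proof.
move=> pQ; move: (pQ); rewrite inE => /and3P[_ Re0 Im0]; have [wit hw] := bad_root_witness.
have [bz hz] := hw _ pQ; rewrite leNgt; apply/negP => lt.
have := cabs_sqr (W p); rewrite W_unit expr1n => W1.
have : cabs (W p - 1) <= 2 * Im (W p).
  rewrite -(@ler_pXn2r _ 2) ?nnegrE ?cabs_ge0 ?mulr_ge0 // cabs_sqr.
  by move: Re0 Im0 W1 {lt hz}; case: (W p) => b c /= *; nra.
have := bad_far1 bz; have := cabs_dist (wit p) (W p) 1; have := inv_mT.
have : 0 < m%:R^-1 :> R by rewrite invr_gt0.
rewrite invfM in hz; rewrite invfM; lra.
Qed.

Let mM : (0 < m <= M)%N. Proof. by rewrite m_gt0 leq_pmull. Qed.

(* The symmetrization keeps only the products of sines of odd frequencies, see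
   [sine_kernel_expansion]. *)
Definition sine_kernel (p : 'I_M) z : R :=
  jackson m (z^* * W p) + jackson m ((- z^*)^* * W p)
  - jackson m ((z^*)^* * W p) - jackson m ((- z)^* * W p).

Definition sine_sum (al : 'I_M -> R) z : R := \sum_(p in Q) al p * sine_kernel p z.

Lemma sine_sumJ al z : sine_sum al z^* = - sine_sum al z.
Proof.
rewrite /sine_sum -sumrN; apply: eq_bigr => p _; rewrite /sine_kernel conjcK; ring.
Qed.

Lemma sine_sumN al z : sine_sum al (- z) = - sine_sum al z.
Proof.
rewrite /sine_sum -sumrN; apply: eq_bigr => p _; rewrite /sine_kernel !conjcN !conjcK !opprK; ring.
Qed.

(** Conjugating [z] changes the sign of the product of imaginary parts, and negating [z] multiplies
    frequency [k] by [(-1)^k]. The four signed terms cancel for even [k] and leave four times this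
    product for odd [k]. *)
Lemma sine_kernel_expansion : exists g : nat -> R, (forall k, 0 <= g k <= 2 / m%:R) /\
  forall p z, cabs z = 1 ->
    sine_kernel p z = \sum_(k < 2 * m) (if odd k then 4 * g k * Im (W p ^+ k) else 0) * Im (z ^+ k).
Proof.
have [g [g_bd gE]] := jackson_expansion R m_gt0; exists g; split=> // p z z1.
have u w : cabs w = 1 -> cabs (w^* * W p) = 1 := rotate_unit zeta_prim p.
have zJ : cabs z^* = 1 by rewrite cabsJ.
rewrite /sine_kernel !gE ?u ?cabsN // -big_split -!sumrB /=; apply: eq_bigr => k _.
rewrite !conjcN conjcK.
have sgn y : (- y * W p) ^+ k = (if odd k then -1 else 1) * (y * W p) ^+ k.
  by rewrite mulNr -mulN1r exprMn -signr_odd; case: (odd k).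
rewrite !sgn !exprMn -conjcX; move: (z ^+ k) (W p ^+ k) => [x1 y1] [x2 y2].
by case: (odd k) => /=; ring.
Qed.

Lemma sine_sum_le al z : (forall p, `|al p| <= 1) -> cabs z = 1 -> `|sine_sum al z| <= 64.
Proof.
move=> al1 z1; apply: (le_trans (ler_norm_sum _ _ _)).
pose S w : R := \sum_(p < M) jackson m (w^* * W p).
have S16 w : cabs w = 1 -> S w <= 16.
  move=> w1; apply: (le_trans (jackson_sum_le zeta_prim mM w1)).
  by rewrite natrM mulfK // gt_eqF.
have h1 := S16 _ z1; have h2 := S16 (- z^*); have h3 := S16 z^*; have h4 := S16 (- z).
rewrite !cabsN !cabsJ in h2 h3 h4.
apply: (@le_trans _ _ (S z + S (- z^*) + S z^* + S (- z))); last first.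
  by have := h2 z1; have := h3 z1; have := h4 z1; lra.
rewrite /S -!big_split /=.
rewrite [leRHS](bigID [in Q]) /= -[leLHS]addr0 lerD //; last first.
  by apply: sumr_ge0 => p _; rewrite !addr_ge0 ?jackson_ge0.
apply: ler_sum => p _; rewrite normrM -[leRHS]mul1r; apply: ler_pM => //.
have k1 := jackson_ge0 m (z^* * W p); have k2 := jackson_ge0 m ((- z^*)^* * W p).
have k3 := jackson_ge0 m ((z^*)^* * W p); have k4 := jackson_ge0 m ((- z)^* * W p).
by rewrite /sine_kernel ler_norml; apply/andP; split; lra.
Qed.

(** Covering with [8 * m] gives the radius [4 / (8 m)], which is why [M] is [16 * m]. Replacing the
    coordinates of the root found by their absolute values moves it no farther from [z], and keeps
    it an [M]-th root of unity since [M] is even. *)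
Lemma bad_near_root z : bad z -> 0 <= Re z -> 0 <= Im z ->
  exists2 p, p \in Q & cabs (z - W p) <= (2 * m%:R)^-1.
Proof.
move=> bz Re0 Im0; have z1 := bad_unit bz.
have m8 : (0 < 8 * m)%N by rewrite muln_gt0.
have m16 : (2 * (8 * m) <= M)%N by rewrite mulnA.
have [p hp] := roots_cover zeta_prim m8 m16 z1.
have {}hp : cabs (z - W p) <= (2 * m%:R)^-1.
  by apply: (le_trans hp); rewrite natrM !invfM; move: mi_gt0; lra.
pose w : R[i] := `|Re (W p)| +i* `|Im (W p)|.
have wM : w ^+ M = 1.
  have pM : W p ^+ M = 1 by rewrite exprAC (prim_expr_order zeta_prim) expr1n.
  have NM (x : R[i]) : (- x) ^+ M = x ^+ M by rewrite exprNn -signr_odd oddM /= expr0 mul1r.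
  have JM (x : R[i]) : x^* ^+ M = (x ^+ M)^* by rewrite conjcX.
  have : [\/ w = W p, w = - W p, w = (W p)^* | w = - (W p)^*].
    rewrite /w; case: (W p) => b c /=.
    case: (leP 0 b) => b0; case: (leP 0 c) => c0.
    - by apply: Or41; rewrite !ger0_norm.
    - by apply: Or43; rewrite ger0_norm // ltr0_norm.
    - by apply: Or44; rewrite ltr0_norm // ger0_norm //; congr (_ +i* _); rewrite opprK.
    - by apply: Or42; rewrite !ltr0_norm.
  by case=> ->; rewrite ?NM ?JM pM ?conjc1.
have [i wi] := prim_rootP zeta_prim wM.
have zw : cabs (z - w) <= (2 * m%:R)^-1.
  apply: le_trans hp; rewrite -(@ler_pXn2r _ 2) ?nnegrE ?cabs_ge0 // !cabs_sqr.
  move: Re0 Im0; rewrite /w; case: (z) => x y; case: (W p) => b c /= x0 y0.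
  have sq (s t : R) : 0 <= s -> (s - `|t|) ^+ 2 <= (s - t) ^+ 2.
    by move=> s0; rewrite !sqrrB real_normK ?num_real // lerD2r lerD2l lerN2 lerMn2r /= ler_wpM2l
      // ler_norm.
  by rewrite lerD ?sq.
exists i; rewrite -?wi //; rewrite inE -wi /= !normr_ge0 !andbT.
by apply/asboolP; exists z.
Qed.

(** The nearest bad root contributes at least 1/16, and the roots of its own cluster carry the same
    sign, so their positive kernels only help. Everything else is at distance at least [100 / m]
    from its centre: four tails of at most [64 / 100^2] each, leaving more than 1/32. *)
Lemma sine_sum_bad_quarter al z : (forall p, al p = 1 \/ al p = -1) ->
  {in Q &, forall p q, fingraph.root near_rel p = fingraph.root near_rel q -> al p = al q} ->
  bad z -> 0 <= Re z -> 0 <= Im z -> 32^-1 <= `|sine_sum al z|.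
Proof.
have signs (s t x1 x2 x3 x4 : R) : (s = 1 \/ s = -1) -> (t = 1 \/ t = -1) ->
    0 <= x1 -> 0 <= x2 -> 0 <= x3 -> 0 <= x4 ->
      0 - x1 - x2 - x3 - x4 <= s * t * (x1 + x2 - x3 - x4).
  by case=> -> [] -> *; lra.
have own (x1 x2 x3 x4 : R) : 0 <= x1 -> 0 <= x2 -> 0 <= x3 -> 0 <= x4 ->
    x1 - 0 - 0 - x3 - x4 <= 1 * (x1 + x2 - x3 - x4) by move=> *; lra.
have clustered (x1 x2 x3 x4 : R) : 0 <= x1 -> 0 <= x2 -> 0 <= x3 -> 0 <= x4 ->
    0 - 0 - 0 - x3 - x4 <= 1 * (x1 + x2 - x3 - x4) by move=> *; lra.
move=> al1 al_const bz Re0 Im0; have z1 := bad_unit bz.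
have [p0 p0Q hp0] := bad_near_root bz Re0 Im0.
pose J w (p : 'I_M) : R := jackson m (w^* * W p).
have J0 w p : 0 <= J w p by apply: jackson_ge0.
pose r : R := 100 / m%:R; have r0 : 0 < r by rewrite divr_gt0.
pose far w : R := \sum_(p < M | r <= cabs (w - W p)) J w p.
have far_le w : cabs w = 1 -> far w <= 64 / 100 ^+ 2.
  move=> w1; apply: (le_trans (jackson_sum_far_le zeta_prim mM w1 r0)).
  suff -> : 4 * M%:R / (m%:R ^+ 3 * r ^+ 2) = 64 / 100 ^+ 2 :> R by [].
  by rewrite natrM /r; field; rewrite gt_eqF.
have main : 16^-1 <= J z p0.
  apply: jackson_near => //; first exact: (rotate_unit zeta_prim).
  rewrite cabs_mul_conj_sub // mulrC -ler_pdivlMr //.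
  by apply: (le_trans hp0); rewrite invfM.
have sep p : p \in Q -> fingraph.root near_rel p != fingraph.root near_rel p0 ->
  r <= cabs (z - W p).
  move=> pQ ne; rewrite leNgt; apply/negP => lt; case/negP: ne.
  rewrite (root_connect near_sym); apply: connect1; rewrite /near_rel /= pQ p0Q /= cabsBC.
  apply: (le_lt_trans (cabs_dist _ z _)); rewrite cabsBC /rho.
  by move: lt hp0 mi_gt0; rewrite /r invfM; lra.
pose al0 := al p0; have al0sq : al0 * al0 = 1 by rewrite /al0; case: (al1 p0) => ->; ring.
have al0n : `|al0| = 1 by rewrite /al0; case: (al1 p0) => ->; rewrite ?normrN normr1.
have -> : `|sine_sum al z| = `|al0 * sine_sum al z| by rewrite normrM al0n mul1r.
apply: le_trans (ler_norm _).
have quarter p : p \in Q -> 0 <= Re (W p) /\ 0 <= Im (W p) by rewrite inE => /and3P[].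
have farQ w (P : pred 'I_M) : {in Q, forall p, P p -> r <= cabs (w - W p)} ->
    \sum_(p in Q | P p) J w p <= far w.
  move=> hw; rewrite /far big_mkcond [leRHS]big_mkcond; apply: ler_sum => p _.
  by case: ifP => [/andP[pQ Pp]|_]; [rewrite hw|case: ifP].
pose ne p := fingraph.root near_rel p != fingraph.root near_rel p0.
have f1 : \sum_(p in Q | ne p) J z p <= far z by apply: farQ => p pQ; apply: sep.
have f2 : \sum_(p in Q | ne p) J (- z^*) p <= far (- z^*).
  apply: farQ => p pQ /(sep p pQ) h; apply: (le_trans h).
  rewrite -(@ler_pXn2r _ 2) ?nnegrE ?cabs_ge0 // !cabs_sqr.
  have [] := quarter _ pQ; move: Re0 {main f1 hp0 h}; case: (z) => x y; case: (W p) => b c /= *;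
    nra.
have r1 : r <= 1.
  rewrite /r ler_pdivrMr // mul1r; have T1 : 1 <= T%:R :> R by rewrite ler1n.
  by move: T_leR; lra.
have f3 : \sum_(p in Q | predT p) J z^* p <= far z^*.
  apply: farQ => p pQ _; apply: (le_trans (bad_root_Im pQ)).
  apply: le_trans (Im_le_cabs _); rewrite -normrN.
  apply: le_trans (ler_norm _); move: Im0 {main f1 f2 hp0}; case: (z) => x y; case: (W p) =>
    b c /=; lra.
have f4 : \sum_(p in Q | predT p) J (- z) p <= far (- z).
  apply: farQ => p pQ _; apply: (le_trans r1).
  rewrite -(@ler_pXn2r _ 2) ?nnegrE ?cabs_ge0 // expr1n !cabs_sqr.
  have [] := quarter _ pQ; have := cabs_sqr z; rewrite z1 expr1n.
  by move: Re0 Im0 {main f1 f2 f3 hp0}; case: (z) => x y; case: (W p) => b c /= *; nra.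
have g1 := far_le _ z1; have g2 := far_le (- z^*); have g3 := far_le z^*; have g4 := far_le (- z).
rewrite !cabsN !cabsJ in g2 g3 g4; have {}g2 := g2 z1; have {}g3 := g3 z1; have {}g4 := g4 z1.
have lower : J z p0 - \sum_(p in Q | ne p) J z p - \sum_(p in Q | ne p) J (- z^*) p
    - \sum_(p in Q | predT p) J z^* p - \sum_(p in Q | predT p) J (- z) p <= al0 * sine_sum al z.
  have -> : J z p0 = \sum_(p in Q) (if p == p0 then J z p else 0).
    by rewrite (bigD1 p0) //= eqxx big1 ?addr0 // => p /andP[_ /negPf ->].
  rewrite !(big_mkcondr _ _ _ ne) !(big_mkcondr _ _ _ predT) -!sumrB mulr_sumr; apply: ler_sum =>
    p pQ.
  rewrite /sine_kernel -!/(J _ p) mulrA.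
  have j1 := J0 z p; have j2 := J0 (- z^*) p; have j3 := J0 z^* p; have j4 := J0 (- z) p.
  case: eqP => [pE|_].
    by move: j1 j2 j3 j4; rewrite pE /ne eqxx /= -/al0 al0sq; apply: own.
  case: ifP => [_|/negbFE/eqP e].
    by apply: (signs al0 (al p)) => //; apply: al1.
  by rewrite (al_const _ _ pQ p0Q e) -/al0 al0sq /=; apply: clustered.
lra.
Qed.

Lemma sine_sum_bad al z : (forall p, al p = 1 \/ al p = -1) ->
  {in Q &, forall p q, fingraph.root near_rel p = fingraph.root near_rel q -> al p = al q} ->
  bad z -> 32^-1 <= `|sine_sum al z|.
Proof.
move=> al1 alc; have half w : bad w -> 0 <= Re w -> 32^-1 <= `|sine_sum al w|.
  move=> bw Re0; case: (leP 0 (Im w)) => [|/ltW] Im0; first exact: sine_sum_bad_quarter.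
  rewrite -normrN -sine_sumJ; apply: sine_sum_bad_quarter => //; first exact: badJ.
    by rewrite ReJ.
  by rewrite ImJ oppr_ge0.
move=> bz; case: (leP 0 (Re z)) => [|/ltW] Re0; first exact: half.
rewrite -normrN -sine_sumN; apply: half; first exact: badN.
by move: Re0; case: (z) => x y /=; rewrite oppr_ge0.
Qed.

(** One sign is chosen per component, with the [2 * m] frequencies as tests. The second hypothesis
    is the resulting coefficient bound: [4 * H] times the Jackson coefficient [2 / m], the largest
    component size [64 * 1616], and the discrepancy. *)
Lemma sine_target (H : R) : 0 <= H ->
  4 * H * (2 / m%:R) * (64 * 1616 * (64 * 1000 * root8 (512 * T%:R * (2 * m%:R) ^+ 3))) <= 1 ->
  exists f : nat -> R, [/\ forall k, `|f k| <= 1, forall k, ~~ odd k -> f k = 0,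
    forall k, (2 * m <= k)%N -> f k = 0 &
    forall z, cabs z = 1 -> `|\sum_(k < 2 * m) f k * Im (z ^+ k)| <= 64 * H /\
      (bad z -> H / 32 <= `|\sum_(k < 2 * m) f k * Im (z ^+ k)|)].
Proof.
move=> H0 Hsmall.
pose B : R := 64 * 1616; have B0 : 0 < B by rewrite mulr_gt0.
pose I := {p : 'I_M | p \in component_reps}.
pose v (k : 'I_(2 * m)) (r : I) :=
  B^-1 * \sum_(q in Q | fingraph.root near_rel q == val r) Im (W q ^+ k).
have v1 k r : `|v k r| <= 1.
  rewrite /v normrM ger0_norm ?invr_ge0 ?(ltW B0) // ler_pdivrMl // mulr1.
  apply: (le_trans (ler_norm_sum _ _ _)).
  have /setIdP[rQ /eqP rr] := valP r.
  apply: (@le_trans _ _ (\sum_(q in Q | fingraph.root near_rel q == val r) 1)).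
    by apply: ler_sum => q _; apply: (le_trans (Im_le_cabs _)); rewrite cabsX W_unit expr1n.
  rewrite sumr_const /B -natrM ler_nat; apply: leq_trans (component_card rQ).
  by apply: subset_leq_card; apply/subsetP => q; rewrite [in X in _ -> X]inE rr.
have cI : (#|{: I}| <= 512 * T)%N by rewrite card_sig; exact: component_reps_card.
have cIJ : (#|{: I}| <= #|{: 'I_(2 * m)}|)%N.
  by rewrite card_ord; apply: (leq_trans cI).
have [e he] := discrepancy_le v1 cIJ.
pose al (p : 'I_M) : R := if insub (fingraph.root near_rel p) is Some r then sgb R (e r) else 1.
have al1 p : al p = 1 \/ al p = -1.
  by rewrite /al; case: insub => [r|]; [rewrite /sgb; case: (e r); [left|right]|left].
have alc : {in Q &, forall p q, fingraph.root near_rel p = fingraph.root near_rel q -> al p = al q}.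
  by move=> p q _ _; rewrite /al => ->.
have [g [g_bd gE]] := sine_kernel_expansion.
pose f k : R := if odd k && (k < 2 * m)%N then H * (4 * g k * \sum_(p in Q) al p * Im (W p ^+ k))
  else 0.
have fE z : cabs z = 1 -> \sum_(k < 2 * m) f k * Im (z ^+ k) = H * sine_sum al z.
  move=> z1; rewrite /sine_sum; under [in RHS]eq_bigr => p _ do rewrite (gE p z z1) mulr_sumr.
  rewrite exchange_big mulr_sumr; apply: eq_bigr => k _ /=; rewrite /f ltn_ord andbT.
  case: (odd k); last by rewrite mul0r big1 ?mulr0 // => p _; rewrite ?mul0r ?mulr0.
  rewrite -mulrA; congr (H * _); rewrite mulr_sumr mulr_suml; apply: eq_bigr => p _; ring.
exists f; split.
- move=> k; rewrite /f; case: ifP => [/andP[_ km]|_]; last by rewrite normr0.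
  have -> : \sum_(p in Q) al p * Im (W p ^+ k) = B * \sum_(r : I) v (Ordinal km) r * sgb R (e r).
    rewrite mulr_sumr (partition_big (fun p => fingraph.root near_rel p) [in component_reps]) /=;
      last first.
      move=> p pQ; rewrite inE (root_root near_sym) eqxx andbT.
      exact: near_connect_Q pQ (connect_root _ _).
    rewrite big_sub; apply: eq_bigr => r _; rewrite mulrA /v mulVKf ?gt_eqF // mulr_suml.
    apply: eq_bigr => p /andP[_ /eqP rp]; rewrite mulrC /al rp valK //.
  have /andP[g0 g2] := g_bd k.
  rewrite (normrM H) (ger0_norm H0) (normrM (4 * g k)) (ger0_norm (mulr_ge0 _ g0)) // (normrM B)
    (ger0_norm (ltW B0)).
  have Sle : `|\sum_(r : I) v (Ordinal km) r * sgb R (e r)| <= 64 * 1000 * root8 (512 * T%:R * (2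
    * m%:R) ^+ 3).
    apply: (le_trans (he _)); apply: ler_wpM2l; first by rewrite mulr_ge0 ?ler0n.
    apply: root8_le; [by rewrite mulr_ge0 ?exprn_ge0 | exact: root8_ge0 |].
    rewrite root8K ?mulr_ge0 ?exprn_ge0 // card_ord natrM;
      apply: (@ler_wpM2r _ ((2 * m%:R) ^+ 3)); first by rewrite exprn_ge0 ?mulr_ge0.
    by rewrite -natrM ler_nat.
  apply: le_trans Hsmall; set S := `|_| in Sle *.
  have -> : H * (4 * g k * (B * S)) = 4 * H * g k * (B * S) by ring.
  apply: ler_pM; [by rewrite !mulr_ge0 | by rewrite mulr_ge0 // ?normr_ge0 // ltW | |].
    by apply: ler_wpM2l; first by rewrite mulr_ge0.
  by apply: ler_wpM2l; first by rewrite ltW.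
- by move=> k /negPf ok; rewrite /f ok.
- by move=> k km; rewrite /f ltnNge km andbF.
move=> z z1; rewrite fE // normrM (ger0_norm H0); split=> [|bz].
  rewrite mulrC ler_wpM2r // sine_sum_le // => p.
  by case: (al1 p) => ->; rewrite ?normrN normr1.
by apply: ler_wpM2l => //; apply: sine_sum_bad.
Qed.

End SineTarget.

(** * Flat polynomials *)

Section TwoSidedSums.
Variable R : realType.
Implicit Types (z : R[i]).

Lemma two_sided_sum h (c d : nat -> R[i]) z : cabs z = 1 ->
  \sum_(l < (2 * h).+1) (if (h <= l)%N then c (l - h)%N else d (h - l)%N) * z ^+ l
  = z ^+ h * (c 0%N + \sum_(k < h) (c k.+1 * z ^+ k.+1 + d k.+1 * z^* ^+ k.+1)).
Proof.
move=> z1; have E : ((2 * h).+1 = h + h.+1)%N by rewrite mul2n -addnn addnS.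
rewrite E big_split_ord /= [X in _ + X]big_ord_recl /= addn0 leqnn subnn.
rewrite big_split /= !mulrDr mulrC addrCA; congr (_ + _); rewrite addrC; congr (_ + _).
  rewrite mulr_sumr; apply: eq_bigr => k _.
  by rewrite /bump /= add1n leq_addr addKn exprD mulrCA.
rewrite (reindex_inj rev_ord_inj) mulr_sumr /=; apply: eq_bigr => k _.
have kh := ltn_ord k; rewrite leqNgt ltn_subrL /= (leq_ltn_trans _ kh) // subKn //.
rewrite mulrCA; congr (_ * _).
have -> : z ^+ h = z ^+ (h - k.+1) * z ^+ k.+1 by rewrite -exprD subnK.
by rewrite -mulrA unit_conjX // mulr1.
Qed.

(** Up to the factor [2 i z^h], a sine polynomial is an ordinary polynomial with [2 h + 1]
    coefficients. Testing it at finitely many roots of unity is thus enough, and these become the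
    rows of the rounding problem. *)
Lemma sine_norming h (M : nat) (zeta : R[i]) (x : nat -> R) (b : R) z :
  M.-primitive_root zeta -> (2 * (2 * h).+1 <= M)%N -> cabs z = 1 ->
  (forall p : 'I_M, `|\sum_(k < h.+1) x k * Im ((zeta ^+ p) ^+ k)| <= b) ->
  `|\sum_(k < h.+1) x k * Im (z ^+ k)| <= 3 / 2 * b.
Proof.
move=> zp hM z1 hb.
pose g l : R[i] := if (h <= l)%N then (if l == h then 0 else (x (l - h)%N)%:C) else - (x (h -
  l)%N)%:C.
have gE w : cabs w = 1 -> cabs (\sum_(l < (2 * h).+1) g l * w ^+ l) = 2 * `|\sum_(k < h.+1) x k *
  Im (w ^+ k)|.
  move=> w1; pose c (k : nat) : R[i] := if k == 0%N then 0 else (x k)%:C.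
  pose d (k : nat) : R[i] := - (x k)%:C.
  have -> : \sum_(l < (2 * h).+1) g l * w ^+ l =
      \sum_(l < (2 * h).+1) (if (h <= l)%N then c (l - h)%N else d (h - l)%N) * w ^+ l.
    apply: eq_bigr => l _; rewrite /g /c /d; case: leqP => // hl.
    by rewrite subn_eq0 [(l <= h)%N]leq_eqVlt ltnNge hl orbF.
  rewrite two_sided_sum // cabsM cabsX w1 expr1n mul1r /c /= add0r.
  rewrite big_ord_recl expr0 [Im 1]/= mulr0 add0r.
  have -> : \sum_(k < h) ((x k.+1)%:C * w ^+ k.+1 + d k.+1 * w^* ^+ k.+1) =
      2 * 'i%C * (\sum_(k < h) x k.+1 * Im (w ^+ k.+1))%:C.
    rewrite rmorph_sum mulr_sumr; apply: eq_bigr => k _.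
    rewrite /d mulNr -mulrBr -conjcX subcJ rmorphM /=; ring.
  rewrite !cabsM cabs_nat cabs_real; congr (_ * _).
  by rewrite /cabs /= expr0n add0r expr1n sqrtr1 mulr1.
have := @roots_norming _ _ _ zp (2 * h).+1 g (2 * b) z isT hM z1.
rewrite gE // => H; suff : 2 * `|\sum_(k < h.+1) x k * Im (z ^+ k)| <= 3 / 2 * (2 * b) by lra.
apply: H => p; rewrite gE ?(prim_rootX_unit zp) // ler_pM2l //; exact: hb.
Qed.

End TwoSidedSums.

(** * Assembling the cosine part and the rounded sine part *)

Section Construction.
Variable R : realType.
Implicit Types (z : R[i]).

Local Notation Cr := (600 * 1000 : R).

(** The squared modulus is the cosine part squared plus [(2 S)^2]. Where the cosine part is small,
    the fractional sine part is at least [H / 32 = 2 * Cr * sqrt h] for [H = 64 * Cr * sqrt h];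
    rounding loses at most half of that. *)
Lemma flat_even_construction (u T a m h : nat) (kappa : R) :
  (2 ^ (2 * u) <= T)%N -> (0 < a)%N -> m = (1616 * a)%N -> (201 * 100 * T <= m)%N ->
    (2 * m <= h)%N ->
  0 < kappa <= 1 ->
  (5 / (100 * T%:R / m%:R)) ^+ 5 * (kappa + 4 * 4 ^+ u / T%:R) < 1 ->
  4 * (64 * Cr * Num.sqrt h%:R) * (2 / m%:R)
    * (64 * 1616 * (64 * 1000 * root8 (512 * T%:R * (2 * m%:R) ^+ 3))) <= 1 ->
  exists c : nat -> R[i], (forall l, c l = -1 \/ c l = 1) /\
    forall z, cabs z = 1 ->
      let P := cabs (\sum_(l < (2 * h).+1) c l * z ^+ l) in
      (kappa * 2 ^+ u <= P \/ 2 * Cr * Num.sqrt h%:R <= P) /\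
      P <= 1 + 8 * 2 ^+ u + 2 * (64 * 64 + 1) * Cr * Num.sqrt h%:R.
Proof.
move=> uT a0 mE Tm mh /andP[k0 k1] small Hsmall.
have T0 : (0 < T)%N by apply: leq_trans uT; rewrite expn_gt0.
have m0 : (0 < m)%N by rewrite mE muln_gt0.
have h0 : (0 < h)%N by apply: leq_trans mh; rewrite muln_gt0.
have Tm1 : (6 * T <= m)%N by apply: leq_trans Tm; rewrite leq_mul2r orbT.
have Th : (6 * T <= h)%N by apply: leq_trans mh; apply: leq_trans Tm1 _; rewrite leq_pmull.
have T0' : 0 < T%:R :> R by rewrite ltr0n.
have m0' : 0 < m%:R :> R by rewrite ltr0n.
set rh := Num.sqrt h%:R in Hsmall *.
have h1 : 1 <= h%:R :> R by rewrite ler1n.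
have rh1 : 1 <= rh by rewrite -(@ler_pXn2r _ 2) ?nnegrE ?sqrtr_ge0 // expr1n sqr_sqrtr //; lra.
pose bad z := cabs z = 1 /\ `|cosineP u T z| <= kappa * 2 ^+ u.
have [zeta zeta_prim] := prim_root_exists R (M := 16 * m) ltac:(by rewrite muln_gt0).
have u0 : 0 < 2 ^+ u :> R by rewrite exprn_gt0.
have bad_unit z : bad z -> cabs z = 1 by case.
have badJ z : bad z -> bad z^* by case=> z1 hz; split; rewrite ?cabsJ ?cosinePJ.
have badN z : bad z -> bad (- z) by case=> z1 hz; split; rewrite ?cabsN ?cosinePN.
have bad_far1 z : bad z -> (100 * T%:R)^-1 < cabs (z - 1).
  case=> z1 hz; rewrite ltNge; apply/negP => hz1.
  have := cosineP_near1 uT z1 hz1; have := le_trans (ler_norm _) hz.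
  have : kappa * 2 ^+ u <= 1 * 2 ^+ u by rewrite ler_pM2r.
  move=> h2 h3 h4; clear - u0 h2 h3 h4; lra.
have bad_sparse (zs : seq R[i]) : size zs = 5%N -> {in zs, forall z, bad z} ->
  pairwise (fun z w => 100 / m%:R <= cabs (z - w)) zs ->
  ~ {in zs &, forall z w, cabs (z - w) <= (4 * T%:R)^-1}.
  move=> s5 sbad sep near.
  have s01 : 0 < (100 * T%:R / m%:R : R) <= 1.
    rewrite divr_gt0 ?mulr_gt0 //= ler_pdivrMr // mul1r -natrM ler_nat.
    by apply: leq_trans Tm; rewrite leq_mul2r orbT.
  apply: (small_cosine_points uT (ltW k0) s01 small s5 sbad).
    apply: sub_pairwise sep => z w /= h2.
    by rewrite -mulrA mulrCA ler_pM2l.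
  move=> z w zin win; have := near _ _ zin win.
  by rewrite -[leRHS]mul1r ler_pdivlMr ?mulr_gt0 // mulrC.
have H0 : 0 <= 64 * Cr * rh by rewrite !mulr_ge0 // sqrtr_ge0.
have [f [f1 f_even f_big hf]] :=
  sine_target a0 mE T0 Tm zeta_prim bad_unit badJ badN bad_far1 bad_sparse H0 Hsmall.
pose cc := cosine_coef R u T.
pose sel k := (0 < k)%N && (cc k == 0).
have [xi xi_prim] := prim_root_exists R (M := 2 * (2 * h).+1) isT.
pose v (j : 'I_(2 * (2 * h).+1)) (i : 'I_h.+1) : R := if sel i then Im ((xi ^+ j) ^+ i) else 0.
have v1 j i : `|v j i| <= 1.
  rewrite /v; case: ifP => _; last by rewrite normr0.
  by apply: (le_trans (Im_le_cabs _)); rewrite cabsX (prim_rootX_unit xi_prim) expr1n.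
have cIJ : (#|{: 'I_h.+1}| <= #|{: 'I_(2 * (2 * h).+1)}|)%N by rewrite !card_ord; clear; lia.
have [e he] := sign_rounding v1 cIJ (fun i : 'I_h.+1 => f1 i).
rewrite card_ord in he.
pose ss k : R := if sel k then sgb R (e (inord k)) else 0.
pose x k : R := if sel k then sgb R (e (inord k)) - f k else 0.
have f_sel k : ~~ sel k -> f k = 0.
  rewrite negb_and -leqNgt leqn0 => /orP[/eqP ->|ck]; first exact: f_even.
  by apply: f_even; apply: contra ck => ok; rewrite /cc cosine_coef_odd.
have ssE k : ss k = x k + f k.
  by rewrite /ss /x; case: ifP => sk; [rewrite subrK|rewrite f_sel ?sk ?addr0].
(* Here [sqrt (4 h + 2) <= 3 * sqrt h], so the bound is [3/2 * (128000 * 3 * sqrt h + 2)], below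
   [600 * 1000 * sqrt h]. *)
have err z : cabs z = 1 -> `|\sum_(k < h.+1) x k * Im (z ^+ k)| <= Cr * rh.
  move=> z1; apply: (le_trans (sine_norming (b :=
    128 * 1000 * Num.sqrt (2 * (2 * h).+1)%:R + 2) xi_prim (leqnn _) z1 _)).
    move=> p; apply: le_trans (he p); rewrite le_eqVlt; apply/orP; left; apply/eqP; congr `|_|.
    by apply: eq_bigr => i _; rewrite /x /v inord_val; case: ifP => _; rewrite ?mul0r // mulrC.
  have : Num.sqrt (2 * (2 * h).+1)%:R <= 3 * rh.
    rewrite -(@ler_pXn2r _ 2) ?nnegrE ?mulr_ge0 ?sqrtr_ge0 // exprMn !sqr_sqrtr // -natrX -natrM
      ler_nat.
    by clear - h0; lia.
  by clear - rh1; lra.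
have fsum z : \sum_(k < h.+1) f k * Im (z ^+ k) = \sum_(k < 2 * m) f k * Im (z ^+ k).
  rewrite [RHS](big_ord_widen h.+1 (fun k => f k * Im (z ^+ k))) ?(leq_trans mh) // [RHS]big_mkcond.
  apply: eq_bigr => k _; case: ltnP => // km; by rewrite f_big ?mul0r.
(* For each [k > 0] exactly one of [cc k] and [ss k] is nonzero, and it is a sign, so both
   [cc k + ss k] and [cc k - ss k] are signs. *)
pose c l : R[i] := if (h <= l)%N then (if (l - h == 0)%N then 1 else (cc (l - h)%N + ss (l -
  h)%N)%:C)
   else (cc (h - l)%N - ss (h - l)%N)%:C.
exists c; split.
  have pm k : (0 < k)%N -> (cc k + ss k = -1 \/ cc k + ss k = 1) /\
    (cc k - ss k = -1 \/ cc k - ss k = 1).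
    move=> kpos; rewrite /ss /sel kpos /=; case: (cosine_coef_sign R uT k) => ck;
      rewrite -/(cc k) in ck *.
    - by rewrite ck eqxx /sgb; case: (e _); rewrite ?add0r ?sub0r ?opprK; split;
      [right|left|left|right].
    - by rewrite ck oner_eq0 addr0 subr0; split; right.
    - by rewrite ck oppr_eq0 oner_eq0 addr0 subr0; split; left.
  move=> l; rewrite /c; case: leqP => hl.
    case: (posnP (l - h)) => [_|lh]; first by right.
    by have [[->|->] _] := pm _ lh; [left; rewrite rmorphN rmorph1|right].
  have hl' : (0 < h - l)%N by rewrite subn_gt0.
  by have [_ [->|->]] := pm _ hl'; [left; rewrite rmorphN rmorph1|right].
move=> z z1 P.
have PE : P ^+ 2 = cosineP u T z ^+ 2 + (2 * \sum_(k < h.+1) ss k * Im (z ^+ k)) ^+ 2.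
  rewrite /P (@two_sided_sum _ h (fun k => if k == 0%N then 1 else (cc k + ss k)%:C) (fun k =>
    (cc k - ss k)%:C)) //.
  rewrite cabsM cabsX z1 expr1n mul1r (cosine_expansion uT z Th) /=.
  have -> : \sum_(k < h.+1) cosine_coef R u T k * Re (z ^+ k) = \sum_(k < h) cc k.+1 * Re (z ^+
    k.+1).
    by rewrite big_ord_recl (cosine_coef0 R uT) mul0r add0r.
  have -> : \sum_(k < h.+1) ss k * Im (z ^+ k) = \sum_(k < h) ss k.+1 * Im (z ^+ k.+1).
    by rewrite big_ord_recl {1}/ss /sel mul0r add0r.
  have -> : 1 + \sum_(k < h) ((cc k.+1 + ss k.+1)%:C * z ^+ k.+1 + (cc k.+1 - ss k.+1)%:C * z^*
    ^+ k.+1)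
    = (1 + 2 * \sum_(k < h) cc k.+1 * Re (z ^+ k.+1)) +i* (2 * \sum_(k < h) ss k.+1 * Im (z ^+
      k.+1)).
    have term k : (cc k.+1 + ss k.+1)%:C * z ^+ k.+1 + (cc k.+1 - ss k.+1)%:C * z^* ^+ k.+1
      = (2 * (cc k.+1 * Re (z ^+ k.+1))) +i* (2 * (ss k.+1 * Im (z ^+ k.+1))).
      rewrite -conjcX; case: (z ^+ k.+1) => b d; apply/eqP; rewrite eq_complex /=.
      by apply/andP; split; apply/eqP; ring.
    rewrite (eq_bigr _ (fun k _ => term (nat_of_ord k))); apply/eqP; rewrite eq_complex;
      apply/andP; split; apply/eqP.
      by rewrite ReD Re_sum mulr_sumr.
    by rewrite ImD Im_sum /= add0r -mulr_sumr.
  by rewrite cabs_sqr /=.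
have P0 : 0 <= P := cabs_ge0 _.
have cle := cosineP_le u T z1.
set C := cosineP u T z in PE cle *; set S := \sum_(k < h.+1) ss k * Im (z ^+ k) in PE.
have [Fle Fbad] := hf z z1; have Ele := err z z1.
have SE : S = \sum_(k < h.+1) x k * Im (z ^+ k) + \sum_(k < 2 * m) f k * Im (z ^+ k).
  by rewrite -fsum -big_split; apply: eq_bigr => k _ /=; rewrite ssE mulrDl.
rewrite -/rh in Fle Fbad; move: Fle Fbad Ele SE.
set E := \sum_(k < h.+1) x k * _; set F := \sum_(k < 2 * m) _ => Fle Fbad Ele SE.
have PC : `|C| <= P by rewrite -(@ler_pXn2r _ 2) ?nnegrE // real_normK ?num_real // PE lerDl
  sqr_ge0.
have PS : 2 * `|S| <= P.
  rewrite -(@ler_pXn2r _ 2) ?nnegrE ?mulr_ge0 // exprMn real_normK ?num_real // PE exprMn lerDr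
    sqr_ge0 //.
have Pup : P <= `|C| + 2 * `|S|.
  have e1 := real_normK (num_real C); have e2 := real_normK (num_real S).
  have cs : 0 <= `|C| * `|S| by rewrite mulr_ge0.
  rewrite -(@ler_pXn2r _ 2) ?nnegrE ?addr_ge0 ?mulr_ge0 // PE.
  by clear - e1 e2 cs; lra.
have SF : `|S| <= `|E| + `|F| by rewrite SE ler_normD.
have FS : `|F| <= `|S| + `|E|.
  have -> : F = S - E by rewrite SE addrAC subrr add0r.
  exact: ler_normB.
split; last by clear - cle Pup SF Fle Ele; lra.
case: (leP `|C| (kappa * 2 ^+ u)) => hC; last by left; apply: le_trans PC; exact: ltW.
have {}Fbad := Fbad (conj z1 hC).
by right; clear - PS FS Fbad Ele; lra.
Qed.

End Construction.

(** * Choice of constants, and passage to all degrees *)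

Section FlatPolynomials.
Variable R : realType.
Implicit Types (z : R[i]).

Lemma exists_nat_ge (x : R) : exists n : nat, x <= n.+1%:R.
Proof.
exists (Num.truncn `|x|); have /truncn_itv/andP[_ /ltW h] := normr_ge0 x.
exact: le_trans (ler_norm _) h.
Qed.

Lemma exists_power4 (X h : nat) : (0 < X)%N -> (X <= h)%N ->
  exists u, (X * 4 ^ u <= h)%N /\ (h < 4 * (X * 4 ^ u))%N.
Proof.
move=> X0 Xh; exists (trunc_log 4 (h %/ X)); have hX : (0 < h %/ X)%N by rewrite divn_gt0.
split; first by rewrite mulnC -leq_divRL // trunc_logP.
by rewrite [(X * _)%N]mulnC mulnA -expnS -ltn_divLR // trunc_log_ltn.
Qed.

Lemma flat_even : exists (d D : R) (h0 : nat), 0 < d /\ forall h, (h0 <= h)%N ->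
  exists c : nat -> R[i], (forall l, c l = -1 \/ c l = 1) /\
    forall z, cabs z = 1 ->
      d * Num.sqrt h%:R <= cabs (\sum_(l < (2 * h).+1) c l * z ^+ l) <= D * Num.sqrt h%:R.
Proof.
have [Cr CrE] : exists Cr : R, Cr = 600 * 1000 by eexists.
have Cr0 : 0 < Cr by rewrite CrE mulr_gt0.
have [B BE] : exists B : R, B = 64 * 1616 * (64 * 1000) by eexists.
have B0 : 0 < B by rewrite BE !mulr_gt0.
(* This value makes the coefficient bound exactly 1 when [sqrt h <= 3 * sqrt m] and the eighth root
   is at most [sqrt m / Y]. The latter amounts to [m / T >= 4096 * Y^8], with [4096 = 512 * 2^3],
   which fixes [G]. *)
have [Y YE] : exists Y : R, Y = 8 * 64 * 3 * Cr * B by eexists.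
have Y0 : 0 < Y by rewrite YE !mulr_gt0.
have [G hG] := exists_nat_ge (4096 * Y ^+ 8).
pose Gam := (1616 * (201 * 100 * G.+1))%N.
have Gam0 : (0 < Gam)%N by rewrite !muln_gt0.
have Gam0' : 0 < Gam%:R :> R by rewrite ltr0n.
have GamG : G.+1%:R <= Gam%:R :> R by rewrite ler_nat /Gam mulnA leq_pmull.
(* With [Gam = m / T], this is the interpolation factor [(5 / s)^5] for [s = 100 * T / m]. Then
   [kappa] and [A] are chosen so that the two errors, multiplied by [X], are at most 1/4 each. *)
have [X XE] : exists X : R, X = (Gam%:R / 20) ^+ 5 by eexists.
have X0 : 0 < X by rewrite XE exprn_gt0 // divr_gt0.
have X1 : 1 <= X.
  rewrite XE.
  apply: exprn_ege1; rewrite ler_pdivlMr // mul1r ler_nat.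
  by rewrite /Gam -[20%N]muln1 leq_mul // !muln_gt0.
have [A hA] := exists_nat_ge (16 * X).
have [kappa kE] : exists kappa : R, X * kappa = 4^-1.
  by exists (4 * X)^-1; rewrite invfM mulrCA divff ?mulr1 // gt_eqF.
have kappa0 : 0 < kappa by rewrite -(pmulr_rgt0 _ X0) kE invr_gt0.
have kappa1 : kappa <= 1 by rewrite -(ler_pM2l X0) kE mulr1; clear - X1; lra.
pose m0 := (Gam * A.+1)%N; have m00 : (0 < m0)%N by rewrite muln_gt0 Gam0.
have m00' : 0 < m0%:R :> R by rewrite ltr0n.
(* Since [h <= 8 * m0 * 4 ^ u], the first entry converts the lower bound [kappa * 2 ^+ u] into a
   multiple of [sqrt h]. *)
pose d := Num.min (kappa / Num.sqrt (8 * m0%:R)) (2 * Cr).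
pose D : R := 9 + 2 * (64 * 64 + 1) * Cr.
have s0 : 0 < Num.sqrt (8 * m0%:R) :> R by rewrite sqrtr_gt0 mulr_gt0.
exists d, D, (2 * m0)%N; split; first by rewrite lt_min divr_gt0 ?mulr_gt0.
have mm0 : (0 < 2 * m0)%N by rewrite muln_gt0.
move=> h hh; have [u [u1 u2]] := exists_power4 mm0 hh.
pose T := (A.+1 * 4 ^ u)%N; pose a := (201 * 100 * G.+1 * T)%N; pose m := (1616 * a)%N.
have mE : m = (Gam * T)%N by rewrite /m /a /Gam !mulnA.
have mE' : m = (m0 * 4 ^ u)%N by rewrite mE /T mulnA.
have p4 : (0 < 4 ^ u)%N by rewrite expn_gt0.
have T0 : (0 < T)%N by rewrite muln_gt0.
have a0 : (0 < a)%N by rewrite !muln_gt0.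
have m_gt0 : (0 < m)%N by rewrite muln_gt0.
have uT : (2 ^ (2 * u) <= T)%N by rewrite expnM leq_pmull.
have Tm : (201 * 100 * T <= m)%N.
  apply: (@leq_trans a); last by rewrite leq_pmull.
  by rewrite leq_mul2r leq_pmulr // orbT.
have mh : (2 * m <= h)%N by rewrite mE' mulnA.
have hm : (h <= 8 * m)%N by apply: ltnW; rewrite mE'; move: u2; rewrite !mulnA.
have h_gt0 : (0 < h)%N by apply: leq_trans mh; rewrite muln_gt0.
have T0' : 0 < T%:R :> R by rewrite ltr0n.
have m0' : 0 < m%:R :> R by rewrite ltr0n.
have G0' : 0 < Gam%:R :> R by [].
have mT : m%:R = Gam%:R * T%:R :> R by rewrite mE natrM.
have small : (5 / (100 * T%:R / m%:R)) ^+ 5 * (kappa + 4 * 4 ^+ u / T%:R) < 1.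
  have -> : 5 / (100 * T%:R / m%:R) = Gam%:R / 20 :> R.
    have : T%:R != 0 :> R by rewrite gt_eqF.
    have : Gam%:R != 0 :> R by rewrite gt_eqF.
    rewrite mT; move: Gam%:R T%:R => x y; clear => x0 y0.
    by field; rewrite x0 y0.
  have -> : 4 * 4 ^+ u / T%:R = 4 / A.+1%:R :> R.
    rewrite /T natrM natrX; have : A.+1%:R != 0 :> R by rewrite pnatr_eq0.
    have : 4 ^+ u != 0 :> R by rewrite expf_neq0 // pnatr_eq0.
    by move: (4 ^+ u) A.+1%:R => x y; clear => x0 y0; field; rewrite x0 y0.
  rewrite -XE mulrDr kE.
  have : X * (4 / A.+1%:R) <= 4^-1.
    by rewrite mulrA ler_pdivrMr ?ltr0n //; clear - hA; lra.
  by move: (X * _) => x; clear; lra.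
pose rh : R := Num.sqrt h%:R; pose rm : R := Num.sqrt m%:R.
have rh0 : 0 <= rh := sqrtr_ge0 _.
have rm0 : 0 < rm by rewrite sqrtr_gt0.
have rm2 : rm ^+ 2 = m%:R by rewrite sqr_sqrtr // ltW.
have rh2 : rh ^+ 2 = h%:R by rewrite sqr_sqrtr.
have rhm : rh <= 3 * rm.
  rewrite -(@ler_pXn2r _ 2) ?nnegrE ?mulr_ge0 ?(ltW rm0) // exprMn rm2 rh2 -natrX -natrM ler_nat.
  by apply: (leq_trans hm); rewrite leq_mul2r orbT.
have r8 : root8 (512 * T%:R * (2 * m%:R) ^+ 3) <= rm * Y^-1.
  apply: root8_le; first by rewrite !mulr_ge0 ?exprn_ge0 ?mulr_ge0.
    by rewrite mulr_ge0 ?invr_ge0 ?ltW.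
  have -> : (rm * Y^-1) ^+ 8 = m%:R ^+ 3 * (m%:R / Y ^+ 8) by rewrite exprMn (exprM _ 2 4) rm2
    exprS exprVn; ring.
  have -> : 512 * T%:R * (2 * m%:R) ^+ 3 = m%:R ^+ 3 * (4096 * T%:R) :> R by ring.
  rewrite ler_pM2l ?exprn_gt0 // ler_pdivlMr ?exprn_gt0 // mulrAC mT ler_pM2r //.
  exact: le_trans GamG.
have Hsmall : 4 * (64 * Cr * rh) * (2 / m%:R)
    * (64 * 1616 * (64 * 1000 * root8 (512 * T%:R * (2 * m%:R) ^+ 3))) <= 1.
  have q0 : 0 <= root8 (512 * T%:R * (2 * m%:R) ^+ 3 : R) := root8_ge0 _.
  move: (root8 _) r8 q0 => q r8 q0.
  have -> : 4 * (64 * Cr * rh) * (2 / m%:R) * (64 * 1616 * (64 * 1000 * q)) = 512 * Cr * B *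
    m%:R^-1 * (rh * q).
    by rewrite BE; clear; ring.
  have K0 : 0 <= 512 * Cr * B * m%:R^-1 by rewrite !mulr_ge0 ?invr_ge0 // ltW.
  have step : rh * q <= 3 * rm * (rm * Y^-1) by apply: ler_pM.
  apply: le_trans (ler_wpM2l K0 step) _.
  rewrite le_eqVlt; apply/orP; left; apply/eqP.
  transitivity (8 * 64 * 3 * Cr * B * Y^-1 * (rm ^+ 2 * m%:R^-1)); first by clear; ring.
  by rewrite -YE rm2 !divff ?mulr1 ?gt_eqF.
rewrite CrE in Hsmall.
have [c [c1 hc]] := flat_even_construction uT a0 erefl Tm mh (introT andP (conj kappa0 kappa1))
  small Hsmall.
exists c; split=> // z z1; have [Plow Pup] := hc z z1.
have u0 : 0 < 2 ^+ u :> R by rewrite exprn_gt0.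
have u4 : (2 ^+ u) ^+ 2 = (4 ^ u)%:R :> R by rewrite -exprM mulnC exprM natrX; congr (_ ^+ _); ring.
have u_le : 2 ^+ u <= rh.
  rewrite -(@ler_pXn2r _ 2) ?nnegrE ?(ltW u0) // u4 rh2 ler_nat.
  by apply: leq_trans mh; rewrite mE' mulnA leq_pmull.
have rh1 : 1 <= rh by rewrite -(@ler_pXn2r _ 2) ?nnegrE // expr1n rh2 ler1n.
apply/andP; split; last first.
  by apply: (le_trans Pup); rewrite -/rh /D -CrE; clear - u_le rh1; lra.
rewrite -/rh; have [hk|hCr] := Plow.
  apply: le_trans hk; apply: (@le_trans _ _ (kappa / Num.sqrt (8 * m0%:R) * rh)).
    by rewrite ler_wpM2r // ge_min lexx.
  rewrite -mulrA ler_pM2l // mulrC ler_pdivrMr //.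
  rewrite -(@ler_pXn2r _ 2) ?nnegrE ?mulr_ge0 ?(ltW u0) ?(ltW s0) // exprMn rh2 u4 sqr_sqrtr
    ?mulr_ge0 //.
  by rewrite -!natrM ler_nat; apply: (leq_trans hm); rewrite mE' mulnA mulnC.
apply: le_trans hCr; rewrite -CrE -/rh ler_wpM2r // ge_min lexx orbT //.
Qed.

(* With [S = z + ... + z^n], [z^(n+1) conj(S) = S]: if [S] is close to 1, then so is
   [z^(n+1)], hence also [z], hence [S] is close to [n]. *)
Lemma all_plus_but_first_lower_bound n z : (2 <= n)%N -> cabs z = 1 ->
  (4 * n%:R ^+ 2)^-1 <= cabs (\sum_(l < n.+1) (if l == 0%N :> nat then -1 else 1) * z ^+ l).
Proof.
move=> n2 z1; rewrite leNgt; apply/negP.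
rewrite big_ord_recl /= expr0 mulr1; under eq_bigr do rewrite mul1r.
set S := \sum_(i < n) _ => small.
have n0 : 2 <= n%:R :> R by rewrite ler_nat.
set eps := cabs _ in small; have eps0 : 0 <= eps := cabs_ge0 _.
have epsE : cabs (S - 1) = eps by rewrite /eps addrC.
have conjS : z ^+ n.+1 * S^* = S.
  rewrite /S rmorph_sum mulr_sumr (reindex_inj rev_ord_inj) /=; apply: eq_bigr => k _.
  have kn := ltn_ord k; rewrite /bump /= !add1n conjcX subnSK //.
  have -> : z ^+ n.+1 = z ^+ k.+1 * z ^+ (n - k) by rewrite -exprD addSn subnKC // ltnW.
  by rewrite -mulrA unit_conjX // mulr1.
have h1 : cabs (z ^+ n.+1 - S) <= eps.
  rewrite -{1}conjS -{1}[z ^+ n.+1]mulr1 -mulrBr cabsM cabsX z1 expr1n mul1r.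
  by rewrite -(conjc1 R) -rmorphB cabsJ cabsBC epsE.
have h2 : cabs (z ^+ n.+1 - 1) <= 2 * eps.
  by have := cabs_dist (z ^+ n.+1) S 1; rewrite epsE; lra.
have SE : S = z * \sum_(i < n) z ^+ i.
  by rewrite mulr_sumr; apply: eq_bigr => k _; rewrite /bump /= add1n exprS.
have h3 : 2 * cabs (z - 1) <= 4 * eps.
  have E : 2 * (z - 1) = (z ^+ n.+1 - 1) - (S - 1) * (z - 1).
    have -> : (S - 1) * (z - 1) = z * ((z - 1) * \sum_(i < n) z ^+ i) - (z - 1) by rewrite SE; ring.
    by rewrite -subrX1 exprS; ring.
  have z2 : cabs (z - 1) <= 2 by have := cabsB z 1; rewrite z1 cabs1; lra.
  rewrite -[2 in leLHS](cabs_nat R 2) -cabsM E; apply: (le_trans (cabsB _ _)).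
  by rewrite cabsM epsE; have := cabs_ge0 (z - 1); nra.
have h4 : cabs (n%:R - S) <= n%:R * (n%:R * cabs (z - 1)).
  have -> : n%:R - S = \sum_(i < n) (1 ^+ i.+1 - z ^+ i.+1).
    have SE' : S = \sum_(i < n) z ^+ i.+1 by rewrite /S; apply: eq_bigr => k _;
      rewrite /bump /= add1n.
    rewrite sumrB -SE'; congr (_ - S).
    by under eq_bigr do rewrite expr1n; rewrite sumr_const card_ord.
  apply: (le_trans (cabs_sum _ _ _)).
  have -> : n%:R * (n%:R * cabs (z - 1)) = \sum_(i < n) n%:R * cabs (z - 1).
    by rewrite sumr_const card_ord mulr_natl.
  apply: ler_sum => k _; apply: (le_trans (cabs_subX _ (cabs1 R) z1)).
  by rewrite cabsBC; apply: ler_wpM2r; rewrite ?cabs_ge0 // ler_nat.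
have h5 : n%:R - 1 <= cabs (n%:R - S) + cabs (S - 1).
  have := cabs_dist n%:R S 1; apply: le_trans.
  by have := @cabs_sub_ge R n%:R 1; rewrite cabs_nat cabs1.
have n20 : 0 < 4 * n%:R ^+ 2 :> R by rewrite mulr_gt0 ?exprn_gt0 //; lra.
have h6 : eps * (4 * n%:R ^+ 2) < 1.
  by rewrite -ltr_pdivlMr // mul1r.
rewrite epsE in h5.
have h7 : n%:R * (n%:R * cabs (z - 1)) <= n%:R * (n%:R * (2 * eps)) by do 2! (apply: ler_wpM2l;
  first by rewrite ler0n); lra.
have h8 : eps * 16 <= eps * (4 * n%:R ^+ 2) by apply: ler_wpM2l => //; nra.
clear - h4 h5 h6 h7 h8 n0; lra.
Qed.

Definition flat_signs (n : nat) (d D : R) := exists c : nat -> R[i],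
  (forall l, c l = -1 \/ c l = 1) /\ forall z, cabs z = 1 ->
    d * Num.sqrt n%:R <= cabs (\sum_(l < n.+1) c l * z ^+ l) <= D * Num.sqrt n%:R.

Lemma flat_signs_le n d D d' D' : d' <= d -> D <= D' -> flat_signs n d D -> flat_signs n d' D'.
Proof.
move=> dd DD [c [c1 hc]]; exists c; split=> // z z1; have /andP[h1 h2] := hc z z1.
by apply/andP; split; [apply: le_trans h1|apply: (le_trans h2)]; apply: ler_wpM2r;
  rewrite ?sqrtr_ge0.
Qed.

(** An odd degree is reached by adding one monomial of modulus 1. This is harmless once
    [d * sqrt h >= 2], which the choice of [K] guarantees. *)
Lemma flat_signs_large : exists (d D : R) (n0 : nat), 0 < d /\
  forall n, (n0 <= n)%N -> flat_signs n d D.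
Proof.
have [d [D [h0 [d0 heven]]]] := flat_even.
have [K hK] := exists_nat_ge (4 / d ^+ 2).
exists (d / 4), (D + 1), (2 * (h0 + K.+1))%N; split=> [|n hn]; first by rewrite divr_gt0.
have nE : n = (odd n + 2 * n./2)%N by rewrite -{1}(odd_double_half n) mul2n.
have hh : (h0 + K.+1 <= n./2)%N by move: hn; rewrite {1}nE; case: (odd n); lia.
set h := n./2 in nE hh.
have [c [c1 hc]] := heven h (leq_trans (leq_addr _ _) hh).
exists c; split=> // z z1; have /andP[lo up] := hc z z1.
have hR : K.+1%:R <= h%:R :> R by rewrite ler_nat (leq_trans _ hh) // leq_addl.
have rh0 : 0 <= Num.sqrt h%:R :> R := sqrtr_ge0 _.
have h1 : (0 < h)%N by apply: leq_trans hh; rewrite addnS.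
have rh1 : 1 <= Num.sqrt h%:R :> R by rewrite -(@ler_pXn2r _ 2) ?nnegrE // expr1n sqr_sqrtr //
  ler1n.
have drh : 2 <= d * Num.sqrt h%:R.
  rewrite -(@ler_pXn2r _ 2) ?nnegrE ?mulr_ge0 ?(ltW d0) // exprMn sqr_sqrtr // mulrC -ler_pdivrMr
    ?exprn_gt0 //.
  by apply: le_trans hR; apply: le_trans hK; rewrite -natrX.
have rhn : Num.sqrt h%:R <= Num.sqrt n%:R :> R.
  by rewrite ler_wsqrtr // ler_nat nE; clear; lia.
have rnh : Num.sqrt n%:R <= 2 * Num.sqrt h%:R :> R.
  rewrite -(@ler_pXn2r _ 2) ?nnegrE ?mulr_ge0 ?sqrtr_ge0 // exprMn !sqr_sqrtr // -natrX -natrM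
    ler_nat.
  by rewrite nE; case: (odd n); clear - h1; lia.
set P := cabs (\sum_(l < (2 * h).+1) c l * z ^+ l) in lo up.
have close : P - 1 <= cabs (\sum_(l < n.+1) c l * z ^+ l) <= P + 1.
  rewrite nE; case: (odd n); rewrite ?add0n ?add1n; last by rewrite -/P; apply/andP; split; lra.
  rewrite big_ord_recr /=.
  have e1 : cabs (c (2 * h).+1 * z ^+ (2 * h).+1) = 1.
    by rewrite cabsM cabsX z1 expr1n; case: (c1 (2 * h).+1) => ->; rewrite ?cabsN cabs1 mulr1.
  set E := c _ * _ in e1 *.
  have a1 := cabsD (\sum_(l < (2 * h).+1) c l * z ^+ l) E.
  have a2 := cabsB (\sum_(l < (2 * h).+1) c l * z ^+ l + E) E.
  rewrite addrK -/P in a2; rewrite -/P in a1; clear - a1 a2 e1.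
  by apply/andP; split; lra.
have /andP[l1 l2] := close; apply/andP; split.
  by apply: le_trans l1; nra.
apply: (le_trans l2); nra.
Qed.

(** With all signs equal there would be zeros at roots of unity; flipping the constant term removes
    them, and a lower bound depending on the degree is enough for finitely many degrees. *)
Lemma flat_signs_small n n0 : (2 <= n)%N -> (n < n0)%N ->
  flat_signs n (4 * n0%:R ^+ 3)^-1 (2 * n0%:R).
Proof.
move=> n2 nn0; exists (fun l => if l == 0%N then -1 else 1); split.
  by move=> l; case: ifP => _; [left|right].
have nR : 2 <= n%:R :> R by rewrite ler_nat.
have nnR : n%:R <= n0%:R :> R by rewrite ler_nat ltnW.
have n00 : 0 < n0%:R :> R by lra.
have rn0 : 0 <= Num.sqrt n%:R :> R := sqrtr_ge0 _.
have rn2 : Num.sqrt n%:R ^+ 2 = n%:R :> R by rewrite sqr_sqrtr.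
have rn1 : 1 <= Num.sqrt n%:R :> R by rewrite -(@ler_pXn2r _ 2) ?nnegrE // expr1n rn2; lra.
have rnn : Num.sqrt n%:R <= n%:R :> R by rewrite -[leRHS]rn2 expr2 ler_peMr.
move=> z z1; apply/andP; split.
  apply: le_trans (all_plus_but_first_lower_bound n2 z1).
  have np : 0 < n%:R :> R by lra.
  rewrite ler_pdivrMl ?mulr_gt0 ?exprn_gt0 // ler_pdivlMr ?mulr_gt0 ?exprn_gt0 //.
  have h3 : n%:R ^+ 3 <= n0%:R ^+ 3 :> R by rewrite lerXn2r ?nnegrE ?(ltW np) ?(ltW n00).
  have h2 : Num.sqrt n%:R * n%:R ^+ 2 <= n%:R * n%:R ^+ 2 :> R by rewrite ler_pM2r ?exprn_gt0.
  by clear - h2 h3; lra.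
apply: (@le_trans _ _ n.+1%:R).
  apply: (le_trans (cabs_sum _ _ _)); rewrite -[n.+1 in leRHS]card_ord -sumr_const.
  by apply: ler_sum => k _; rewrite cabsM cabsX z1 expr1n mulr1; case: ifP => _;
    rewrite ?cabsN cabs1.
by rewrite -natr1; nra.
Qed.

End FlatPolynomials.

(* `|w| on R[i] is the complex modulus, valued in R[i]; the inequalities are in
   the order of R[i], which extends that of R along the embedding x |-> x%:C. *)
Theorem theorem1p1 (R : realType) :
  exists (eta1 eta2 : R) (P : nat -> {poly R[i]}),
    [/\ 0 < eta1, eta1 < eta2 &
      forall n : nat, (2 <= n)%N ->
        Littlewood n (P n) /\
        forall z : R[i], `|z| = 1 ->
          (eta1 * Num.sqrt n%:R)%:C <= `|(P n).[z]|
          /\ `|(P n).[z]| <= (eta2 * Num.sqrt n%:R)%:C].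
Proof.
have [d [D [n0 [d0 large]]]] := flat_signs_large R.
pose eta1 := Num.min d (4 * n0.+1%:R ^+ 3)^-1.
pose E := Num.max D (2 * n0.+1%:R).
have e1 : 0 < eta1 by rewrite lt_min d0 invr_gt0 mulr_gt0 // exprn_gt0.
have E0 : 0 < E by rewrite lt_max mulr_gt0 ?orbT.
(* Taking [eta1 + E] with [E > 0] as the upper constant gives [eta1 < eta2] without comparing the
   two bounds. *)
have flat n : (2 <= n)%N -> flat_signs n eta1 (eta1 + E).
  move=> n2; case: (leqP n0 n) => nn0.
    apply: flat_signs_le (large n nn0); first by rewrite ge_min lexx.
    by apply: ler_wpDl; [exact: ltW | rewrite le_max lexx].
  have nn1 : (n < n0.+1)%N by apply: ltn_trans nn0 _.
  apply: flat_signs_le (flat_signs_small R n2 nn1); first by rewrite ge_min lexx orbT.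
  by apply: ler_wpDl; [exact: ltW | rewrite le_max lexx orbT].
(* Stated for all [n], with arbitrary coefficients below degree 2, so that choice yields one
   sequence. *)
have flat' n : exists c : nat -> R[i], (2 <= n)%N -> (forall l, c l = -1 \/ c l = 1) /\
    forall z, cabs z = 1 ->
      eta1 * Num.sqrt n%:R <= cabs (\sum_(l < n.+1) c l * z ^+ l) <= (eta1 + E) * Num.sqrt n%:R.
  case: (leqP 2 n) => [n2|_]; last by exists (fun=> 0).
  by have [c hc] := flat n n2; exists c.
pose c n := sval (cid (flat' n)); have hc n := svalP (cid (flat' n)); rewrite -/(c _) in hc.
exists eta1, (eta1 + E), (fun n => \sum_(j < n.+1) c n j *: 'X^j); split=> //;
  first by rewrite ltrDl.
move=> n n2; have [c1 hn] := hc n n2; split; first by exists (fun j : 'I_n.+1 => c n j) => // j;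
  apply: c1.
move=> z z1; have {}z1 : cabs z = 1 by apply: complexI; rewrite -normc_cabs z1 rmorph1.
have -> : (\sum_(j < n.+1) c n j *: 'X^j).[z] = \sum_(j < n.+1) c n j * z ^+ j.
  by rewrite horner_sum; apply: eq_bigr => j _; rewrite !hornerE.
by have /andP[h1 h2] := hn z z1; rewrite normc_cabs !lecR.
Qed.
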